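(* The weak-type $(1,1)$ inequality and the $L^p$ estimates for $1<p<2$ fail in general for noncommutative tangent martingales. That is: (a) There is no finite universal constant $C$ such that $$\tau\big(I_{[1,\infty)}(|y_N|)\big)\leq C\|x_N\|_1,\qquad N=0,1,2,\ldots,$$ for all filtered von Neumann algebras $(\mathcal{M},(\mathcal{M}_n)_{n\ge0},\tau)$ with normal semifinite faithful trace and all self-adjoint martingales $x=(x_n)_{n\ge0}$, $y=(y_n)_{n\ge0}$ with tangent difference sequences. (b) For every $1<p<2$ there is no finite constant $C_p$ depending only on $p$ such that $$\|y_N\|_p\leq C_p\|x_N\|_p,\qquad N=0,1,2,\ldots,$$ for all filtered von Neumann algebras and all self-adjoint martingales $x,y$ with tangent difference sequences.
   Context: $\|x\|_p=(\tau(|x|^p))^{1/p}$ is the norm of the noncommutative space $L^p(\mathcal{M},\tau)$; $I_{[1,\infty)}(a)$ is the spectral projection of the self-adjoint operator $a$ corresponding to $[1,\infty)$. A filtration is a nondecreasing sequence $(\mathcal{M}_n)_{n\ge0}$ of von Neumann subalgebras of $\mathcal{M}$ whose union is weak$^*$-dense in $\mathcal{M}$, together with the normal $\tau$-preserving conditional expectations $\mathcal{E}_n:\mathcal{M}\to\mathcal{M}_n$; we put $\mathcal{E}_{-1}=\mathcal{E}_0$. A martingale is a sequence $(x_n)$ in $L^1(\mathcal{M})+\mathcal{M}$, adapted to the filtration, with $\mathcal{E}_n(x_{n+1})=x_n$; its difference sequence is $dx_0=x_0$, $dx_n=x_n-x_{n-1}$ for $n\ge1$. Two adapted sequences $a=(a_n)_{n\ge0}$,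 $b=(b_n)_{n\ge0}$ are tangent if for every bounded Borel function $\varphi$, $\mathcal{E}_{n-1}(\varphi(a_n))=\mathcal{E}_{n-1}(\varphi(b_n))$ for $n=0,1,2,\ldots$. *)

(* Defs.v *)
From HB Require Import structures.
From mathcomp Require Import all_boot all_order all_algebra.
From mathcomp Require Import sesquilinear.
From mathcomp Require Import all_classical all_reals all_analysis.
From mathcomp Require Import complex.

Set Implicit Arguments.
Unset Strict Implicit.
Unset Printing Implicit Defensive.

Import Order.TTheory GRing.Theory Num.Theory.
Import numFieldNormedType.Exports.

Local Open Scope classical_set_scope.
Local Open Scope ring_scope.
Local Open Scope complex_scope.

(* Complex Hilbert spaces; the inner product is linear in its first argument. *)
Record hilbertSpace (R : realType) := HilbertSpace {
  hilbert_sort :> completeNormedModType R[i];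
  hdot : {dot hilbert_sort for Num.conj};
  hdot_norm : forall v : hilbert_sort, hdot v v = `|v| ^+ 2 }.

Notation "''[' u , v ]" := (hdot _ u%R v%R)
  (at level 0, format "''[' u ,  v ]") : ring_scope.

Section BoundedOperators.
Context {R : realType} {H : hilbertSpace R}.
Implicit Types (T S : H -> H) (A M N D : set (H -> H)).

Definition bounded_op T : Prop := linear T /\ continuous T.

Definition is_adjoint T S : Prop := forall u v, '[T u, v] = '[u, S v].

Definition commutant A : set (H -> H) :=
  [set T | bounded_op T /\ forall S, A S -> T \o S = S \o T].

(* The second clause already makes M a unital algebra of bounded operators. *)
Definition von_neumann M : Prop :=
  (forall T S, M T -> is_adjoint T S -> M S) /\ commutant (commutant M) = M.

Definition op_ge0 T : Prop := forall v, 0 <= '[T v, v].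
Definition op_le S T : Prop := op_ge0 (T - S).
Definition pos_part M : set (H -> H) := [set T | M T /\ op_ge0 T].

Definition op_directed D : Prop :=
  D !=set0 /\
  forall S T, D S -> D T -> exists U, [/\ D U, op_le S U & op_le T U].

Definition op_sup M D T : Prop :=
  [/\ pos_part M T, forall S, D S -> op_le S T
    & forall U, pos_part M U -> (forall S, D S -> op_le S U) -> op_le T U].

Definition is_projection M T : Prop :=
  [/\ M T, T \o T = T & is_adjoint T T].

Definition is_unitary T : Prop :=
  bounded_op T /\
  exists S, [/\ is_adjoint T S, T \o S = idfun & S \o T = idfun].

(* tau is only meaningful on the positive cone of M. *)
Record nsf_trace M (tau : (H -> H) -> \bar R) : Prop := NsfTrace {
  trace_ge0 : forall T, pos_part M T -> (0 <= tau T)%E;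
  traceD : forall S T, pos_part M S -> pos_part M T ->
    tau (S + T) = (tau S + tau T)%E;
  traceZ : forall (c : R) T, 0 <= c -> pos_part M T ->
    tau (c%:C *: T) = (c%:E * tau T)%E;
  trace_tracial : forall T S, M T -> is_adjoint T S ->
    tau (S \o T) = tau (T \o S);
  trace_faithful : forall T, pos_part M T -> tau T = 0%E -> T = 0;
  trace_normal : forall D T, D `<=` pos_part M -> op_directed D ->
    op_sup M D T -> tau T = ereal_sup (tau @` D);
  trace_semifinite : forall T, pos_part M T -> T <> 0 ->
    exists S, [/\ pos_part M S, S <> 0, op_le S T & (tau S < +oo)%E] }.

Record cond_expectation M N (tau : (H -> H) -> \bar R)
    (E : (H -> H) -> (H -> H)) : Prop := CondExpectation {
  cexp_range : forall T, M T -> N (E T);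
  cexp_linear : forall (c : R[i]) S T, M S -> M T ->
    E (c *: S + T) = c *: E S + E T;
  cexp_pos : forall T, pos_part M T -> op_ge0 (E T);
  cexp_id : forall T, N T -> E T = T;
  cexp_bimodule : forall S T U, N S -> M T -> N U ->
    E (S \o T \o U) = S \o E T \o U;
  cexp_normal : forall D T, D `<=` pos_part M -> op_directed D ->
    op_sup M D T -> op_sup N (E @` D) (E T);
  cexp_trace : forall T, pos_part M T -> tau (E T) = tau T }.

(* The weak* topology of M is given by the functionals
   T |-> \sum_k <T (a k), b k> with a and b square-summable. *)
Definition square_summable (a : nat -> H) : Prop :=
  cvgn (series (fun k => `|a k| ^+ 2 : R[i]^o)).

Definition normal_functional (a b : nat -> H) T : R[i]^o :=
  limn (series (fun k => '[T (a k), b k] : R[i]^o)).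

Definition weak_star_dense A M : Prop :=
  forall (m : nat) (a b : 'I_m -> nat -> H) (T : H -> H) (e : R),
    (forall j, square_summable (a j) /\ square_summable (b j)) ->
    M T -> 0 < e ->
    exists2 S, A S & forall j, `|normal_functional (a j) (b j) (T - S)| < e%:C.

End BoundedOperators.

(* Unbounded operators on H are represented by their graphs. *)
Section UnboundedOperators.
Context {R : realType} {H : hilbertSpace R}.
Implicit Types (G : set (H * H)) (M : set (H -> H)).

Definition op_graph (T : H -> H) : set (H * H) := [set p | p.2 = T p.1].

Definition op_dom G : set H := fst @` G.

Record closed_operator G : Prop := ClosedOperator {
  clop_functional : forall v w w', G (v, w) -> G (v, w') -> w = w';
  clop_linear : forall (c : R[i]) p q, G p -> G q -> G (c *: p + q);
  clop_closed : closed G;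
  clop_dense : dense (op_dom G) }.

Definition adjoint_graph G : set (H * H) :=
  [set p | forall q, G q -> '[q.2, p.1] = '[q.1, p.2]].

Definition self_adjoint G : Prop := closed_operator G /\ adjoint_graph G = G.

Definition graph_comp G1 G2 : set (H * H) :=
  [set p | exists2 u, G2 (p.1, u) & G1 (u, p.2)].

(* Strong sum and difference: closure of the algebraic sum and difference. *)
Definition strong_add G1 G2 : set (H * H) :=
  closure [set p | exists w1 w2,
    [/\ G1 (p.1, w1), G2 (p.1, w2) & p.2 = w1 + w2]].

Definition strong_sub G1 G2 : set (H * H) :=
  closure [set p | exists w1 w2,
    [/\ G1 (p.1, w1), G2 (p.1, w2) & p.2 = w1 - w2]].

Definition affiliated M G : Prop :=
  forall U, commutant M U -> is_unitary U ->
    forall v w, G (v, w) -> G (U v, U w).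

(* Projection-valued Borel measures on R. Only the values of spm on Borel sets
   matter; spm_form v is the scalar measure A |-> <spm A v, v>. *)
Record spectral_measure := SpectralMeasure {
  spm : set R -> H -> H;
  spm_form : H -> {measure set R -> \bar R};
  spm_proj : forall A, measurable A -> is_projection bounded_op (spm A);
  spm_setT : spm setT = idfun;
  spm_setI : forall A B, measurable A -> measurable B ->
    spm (A `&` B) = spm A \o spm B;
  spm_formE : forall v A, measurable A ->
    spm_form v A = (complex.Re '[spm A v, v])%:E }.

Definition spm_dom (E : spectral_measure) (phi : R -> R) : set H :=
  [set v | (\int[spm_form E v]_t ((phi t) ^+ 2)%:E < +oo)%E].

(* Graph of \int phi dE: on its domain <(\int phi dE) v, u> is the integral of
   phi against the complex measure <E(.) v, u>, which is obtained from the
   positive measures <E(.) v, v> by polarization. *)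
Definition spm_integral (E : spectral_measure) (phi : R -> R) : set (H * H) :=
  [set p | spm_dom E phi p.1 /\ forall u, spm_dom E phi u ->
    '[p.2, u] = 4^-1 * \sum_(k < 4) 'i ^+ k *
      (\int[spm_form E (p.1 + 'i ^+ k *: u)]_t phi t)%:C].

(* Borel functional calculus. A self-adjoint operator has exactly one spectral
   measure, so the existential quantifier only names it. *)
Definition borel_calc (phi : R -> R) G : set (H * H) :=
  [set p | exists2 E : spectral_measure,
    spm_integral E (fun t => t) = G & spm_integral E phi p].

Definition modulus G : set (H * H) :=
  borel_calc Num.sqrt (graph_comp (adjoint_graph G) G).

Definition spectral_projection (A : set R) G : set (H * H) :=
  borel_calc \1_A G.

(* Extension of tau to positive self-adjoint operators affiliated with M:
   tau(G) = sup_n tau(\int_[0,n] t dE(t)), with E the spectral measure of G. *)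
Definition trace_ext M (tau : (H -> H) -> \bar R) G : \bar R :=
  ereal_sup [set tau T | T in [set T | pos_part M T /\
    exists n : nat, op_graph T = borel_calc (fun t => t * \1_(`[0, n%:R]) t) G]].

Definition Lp_norm M tau (p : R) G : \bar R :=
  poweR (trace_ext M tau (borel_calc (fun t => t `^ p) (modulus G))) p^-1.

Definition tau_measurable M (tau : (H -> H) -> \bar R) G : Prop :=
  [/\ closed_operator G, affiliated M G & forall e : R, 0 < e ->
    exists P, [/\ is_projection M P, range P `<=` op_dom G
                & (tau (idfun - P)%R <= e%:E)%E]].

Definition L1_space M tau : set (set (H * H)) :=
  [set G | tau_measurable M tau G /\ (Lp_norm M tau 1 G < +oo)%E].

Definition L1_plus_alg M tau : set (set (H * H)) :=
  [set G | exists G1 T,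
    [/\ L1_space M tau G1, M T & G = strong_add G1 (op_graph T)]].

(* The expectation E : M -> N extends by L^1-continuity from M `&` L^1(M) to
   L^1(M), hence to L^1(M) + M; cexp_ext relates x to its expectation y. *)
Definition cexp_ext M N tau (E : (H -> H) -> (H -> H)) (x y : set (H * H)) :
    Prop :=
  exists x1 y1 T, [/\ L1_space M tau x1, L1_space N tau y1, M T,
      x = strong_add x1 (op_graph T)
    & y = strong_add y1 (op_graph (E T))] /\
    exists z : nat -> H -> H, [/\ forall k, M (z k),
      (fun k => Lp_norm M tau 1 (strong_sub x1 (op_graph (z k))))
        @ \oo --> 0%E
    & (fun k => Lp_norm M tau 1 (strong_sub y1 (op_graph (E (z k)))))
        @ \oo --> 0%E].

End UnboundedOperators.

Record filtered_vna (R : realType) := FilteredVna {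
  fvn_space : hilbertSpace R;
  fvn_alg : set (fvn_space -> fvn_space);
  fvn_trace : (fvn_space -> fvn_space) -> \bar R;
  fvn_filt : nat -> set (fvn_space -> fvn_space);
  fvn_cexp : nat -> (fvn_space -> fvn_space) -> (fvn_space -> fvn_space);
  fvn_alg_vn : von_neumann fvn_alg;
  fvn_trace_nsf : nsf_trace fvn_alg fvn_trace;
  fvn_filt_vn : forall n, von_neumann (fvn_filt n);
  fvn_filt_sub : forall n, fvn_filt n `<=` fvn_alg;
  fvn_filt_mono : forall n, fvn_filt n `<=` fvn_filt n.+1;
  fvn_filt_dense : weak_star_dense (\bigcup_n fvn_filt n) fvn_alg;
  fvn_cexpP : forall n,
    cond_expectation fvn_alg (fvn_filt n) fvn_trace (fvn_cexp n) }.

Section Martingales.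
Context {R : realType} {F : filtered_vna R}.
Local Notation H := (fvn_space F).
Local Notation M := (@fvn_alg R F).
Local Notation tau := (@fvn_trace R F).
Implicit Types (x y a b : nat -> set (H * H)).

Definition tr (G : set (H * H)) : \bar R := trace_ext M tau G.

Definition norm_Lp (p : R) (G : set (H * H)) : \bar R := Lp_norm M tau p G.

Definition adapted x : Prop :=
  forall n, L1_plus_alg (fvn_filt n) tau (x n).

Definition martingale x : Prop :=
  adapted x /\
  forall n, cexp_ext M (fvn_filt n) tau (fvn_cexp n) (x n.+1) (x n).

Definition self_adjoint_martingale x : Prop :=
  martingale x /\ forall n, self_adjoint (x n).

Definition mdiff x (n : nat) : set (H * H) :=
  if n is m.+1 then strong_sub (x m.+1) (x m) else x 0%N.

(* The convention E_{-1} = E_0 is rendered by 0.-1 = 0. *)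
Definition tangent a b : Prop :=
  [/\ adapted a, adapted b & forall (n : nat) (phi : R -> R),
    measurable_fun setT phi -> (exists K : R, forall t, `|phi t| <= K) ->
    exists S T, [/\ M S /\ M T, op_graph S = borel_calc phi (a n),
        op_graph T = borel_calc phi (b n)
      & fvn_cexp n.-1 S = fvn_cexp n.-1 T]].

End Martingales.

(* Main.v *)
(* The counterexample lives on C^(N+1) (x) l^2({-1,1}^N), with M the algebra of
   all operators, tau the usual trace and basis vectors e_0, ..., e_N of C^(N+1).
   Put  a_k = e_{0k} + e_{k0}  and  b_k = eps_k (e_{00} + e_{kk}),  where eps_k
   multiplies by the k-th coordinate.  Commuting self-adjoint unitaries g_j
   (negate e_j, flip the j-th coin) satisfy  g_j a_k g_j = -a_k,
   g_j b_k g_j = -b_k  for j = k  and commute with a_k, b_k for j <> k; let M_n be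
   the commutant of {g_j : j > n}, whose conditional expectation is the average
   over the finite group generated by these g_j.  Then (a_k) and (b_k) are
   martingale differences, and they are tangent because a_k^2 = b_k^2,
   a_k^3 = a_k, b_k^3 = b_k: every phi(a_k) is a combination of 1, a_k^2 and a_k.
   The sum of the a_k has rank 2 . 2^N and eigenvalues +-sqrt N, so that
   ||x_N||_p^p = 2 . 2^N N^(p/2), whereas the sum of the b_k acts as eps_k on
   e_k, so that tau(I_[1,oo)(|y_N|)) and ||y_N||_p^p are at least N 2^N.  Taking
   N = n^2 and n large contradicts both inequalities when p < 2. *)

From HB Require Import structures.
Require Import Defs.
From mathcomp Require Import all_boot all_order all_algebra.
From mathcomp Require Import sesquilinear.
From mathcomp Require Import all_classical all_reals all_analysis.
From mathcomp Require Import measurable_realfun.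
From mathcomp Require Import complex.
From mathcomp Require Import ring lra.

Set Implicit Arguments.
Unset Strict Implicit.
Unset Printing Implicit Defensive.

Import Order.TTheory GRing.Theory Num.Theory.
Import numFieldNormedType.Exports.

Local Open Scope classical_set_scope.
Local Open Scope complex_scope.
Local Open Scope ring_scope.

(** * The Hilbert space of functions on a finite set *)

(** The weight of the proof lies in the definitions that the example must meet. Operators are
    graphs, and [borel_calc] quantifies over spectral measures about which nothing is known except
    that they integrate to the given operator. No general spectral theorem is used: every operator
    to be evaluated is [spec_op P lam] for a finite resolution [P], and its eigenvectors alone force
    the values of any spectral measure. Powers, moduli and spectral projections then act on
    eigenvalues. Apart from the zero operator, two kinds of resolution suffice: the standard basis
    for the sum of the coins, and Lagrange interpolation for operators with T^3 = c^2 T, which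
    covers each arrow, each coin and the sum of the arrows. Finite dimension keeps the rest
    elementary: a positive operator is bounded by a multiple of its trace, which yields normality of
    the trace and of the averages, and all L^1 components can be taken to be zero. The threshold p =
    2 comes from noncommutativity: the arrows all meet at e_0 and merge into few eigenvalues of size
    N^(1/2), while the commuting coins keep N separate eigenvalues of modulus 1. The p-th powers
    differ by a factor of order N^(1 - p/2). *)

Section L2.
Context {R : realType} {I : finType}.
Local Notation C := R[i].

(* An alias, so that the product space can carry the Euclidean norm. *)
Definition l2 : Type := {ffun I -> C^o}.

HB.instance Definition _ := Vector.copy l2 {ffun I -> C^o}.

Implicit Types u v w : l2.

Definition l2dot u v : C := \sum_i u i * (v i)^*.

Fact l2dot_bilinear : bilinear_for *%R (Num.conj \; *%R) l2dot.
Proof.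
split=> [u a x y|u a x y] /=; rewrite /l2dot mulr_sumr -big_split;
  apply: eq_bigr => i _; rewrite !ffunE /=.
  by rewrite mulrDl -mulrA.
by rewrite rmorphD rmorphM /= mulrDr mulrCA.
Qed.

HB.instance Definition _ := bilinear_isBilinear.Build C l2 l2 C
  *%R (Num.conj \; *%R) l2dot l2dot_bilinear.

Fact l2dotC u v : l2dot u v = (-1) ^+ false * (l2dot v u)^*.
Proof.
rewrite expr0 mul1r rmorph_sum; apply: eq_bigr => i _.
by rewrite rmorphM /= conjCK mulrC.
Qed.

HB.instance Definition _ :=
  isHermitianSesquilinear.Build C l2 false Num.conj l2dot l2dotC.

Lemma l2dotuu u : l2dot u u = \sum_i `|u i| ^+ 2.
Proof. by apply: eq_bigr => i _; rewrite normCK. Qed.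

Fact l2dot_gt0 u : u != 0 -> 0 < l2dot u u.
Proof.
move=> u0; rewrite lt_def l2dotuu sumr_ge0 ?andbT; last by move=> i _; rewrite exprn_ge0.
apply: contra u0; rewrite psumr_eq0 => [/allP u0|i _]; last by rewrite exprn_ge0.
apply/eqP/ffunP => i; rewrite ffunE; apply/eqP.
by have /implyP/(_ isT) := u0 i (mem_index_enum i); rewrite expf_eq0 normr_eq0.
Qed.

HB.instance Definition _ := isDotProduct.Build C l2 l2dot l2dot_gt0.

Fact l2dot_ge0 u : 0 <= l2dot u u.
Proof. exact: (dnorm_ge0 (l2dot : {dot l2 for Num.conj})). Qed.

Definition l2norm u : C := sqrtC (l2dot u u).

Fact l2norm_triangle u v : l2norm (u + v) <= l2norm u + l2norm v.
Proof. exact: (triangle_lerif (l2dot : {dot l2 for Num.conj}) u v).1. Qed.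

Fact l2normZ (a : C) u : l2norm (a *: u) = `|a| * l2norm u.
Proof.
rewrite /l2norm (dnormZ (l2dot : {dot l2 for Num.conj})).
rewrite sqrtCM ?nnegrE ?exprn_ge0 ?l2dot_ge0 //.
by rewrite sqrCK.
Qed.

Fact l2norm_eq0 u : l2norm u = 0 -> u = 0.
Proof.
move=> /eqP; rewrite (sqrt_dnorm_eq0 (l2dot : {dot l2 for Num.conj})).
by move=> /eqP.
Qed.

HB.instance Definition _ :=
  Lmodule_isNormed.Build C l2 l2norm_triangle l2normZ l2norm_eq0.

Lemma l2_normE u : `|u| = l2norm u. Proof. by []. Qed.

Lemma l2_coord u i : `|u i| <= `|u|.
Proof.
rewrite l2_normE -(sqrCK (normr_ge0 (u i))) ler_sqrtC ?nnegrE ?exprn_ge0 ?l2dot_ge0 //.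
by rewrite l2dotuu (bigD1 i) //= lerDl sumr_ge0 // => j _; rewrite exprn_ge0.
Qed.

Lemma l2_norm_sum u : `|u| <= \sum_i `|u i|.
Proof.
have sum0 : 0 <= \sum_i `|u i| by rewrite sumr_ge0.
rewrite l2_normE -[leRHS](sqrCK) // ler_sqrtC ?nnegrE ?exprn_ge0 ?l2dot_ge0 //.
rewrite l2dotuu expr2 mulr_suml; apply: ler_sum => i _.
by rewrite expr2 ler_wpM2l // (bigD1 i) //= lerDl sumr_ge0.
Qed.

End L2.
Arguments l2 : clear implicits.

(** * Completeness of the complex numbers and of the finite-dimensional space *)

Lemma normr_Re (R : realType) (z : R[i]) : `|complex.Re z|%:C <= `|z|.
Proof. exact: normc_ge_Re. Qed.

Lemma normr_Im (R : realType) (z : R[i]) : `|complex.Im z|%:C <= `|z|.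
Proof.
rewrite -normrN -ReiNIm (le_trans (normr_Re _)) // normrM.
by rewrite complexiE normCi mulr1.
Qed.

(** Real and imaginary parts are 1-Lipschitz, so they carry [F] to Cauchy filters on [R], whose
    limits are reassembled. *)
Lemma complex_complete (R : realType) (F : set_system R[i]^o) :
  ProperFilter F -> cauchy F -> cvg F.
Proof.
move=> FF /cauchy_ballP Fc.
have cvgpart (f : R[i]^o -> R) : (forall x y, `|f x - f y|%:C <= `|x - y|) ->
    cvg (f @ F).
  move=> fL; apply: cauchy_cvg; apply/cauchy_ballP => e e0.
  have [|[A B] /= [FA FB] AB] := Fc e%:C; first by rewrite ltcR.
  exists (f @` A, f @` B) => /=.
    by split; [apply: filterS FA | apply: filterS FB] => x Ax; exists x.
  move=> [_ _] /= [[x Ax <-] [y By <-]].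
  have := AB (x, y) (conj Ax By); rewrite -!ball_normE /= => xy.
  by rewrite -ltcR (le_lt_trans (fL _ _)).
have /cvg_ex [a Fa] : cvg (@complex.Re R @ F).
  by apply: cvgpart => -[x1 x2] [y1 y2]; exact: (normr_Re (Complex (x1 - y1) (x2 - y2))).
have /cvg_ex [b Fb] : cvg (@complex.Im R @ F).
  by apply: cvgpart => -[x1 x2] [y1 y2]; exact: (normr_Im (Complex (x1 - y1) (x2 - y2))).
apply/cvg_ex; exists (Complex a b); apply/cvgrPdist_lt => e e0.
(* A positive element of [R[i]] has zero imaginary part, so the complex radius is handled as a real
   one. *)
have [eE eR0] : e = (complex.Re e)%:C /\ 0 < complex.Re e.
  by case: e e0 => x y; rewrite ltcE /= => /andP[/eqP -> x0]; split.
have e20 : 0 < complex.Re e / 2 by rewrite divr_gt0.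
near=> z.
have az : `|a - complex.Re z| < complex.Re e / 2 by near: z; move: e20; apply: cvgr_dist_lt.
have bz : `|b - complex.Im z| < complex.Re e / 2 by near: z; move: e20; apply: cvgr_dist_lt.
rewrite eE [Complex a b - z]complexE.
have -> : complex.Re (Complex a b - z) = a - complex.Re z by case: (z).
have -> : complex.Im (Complex a b - z) = b - complex.Im z by case: (z).
rewrite (le_lt_trans (ler_normD _ _)) //.
rewrite normrM complexiE normCi mul1r !normc_def /= expr0n /= !addr0 !sqrtr_sqr -rmorphD ltcR.
by rewrite [ltRHS](splitr) ltrD.
Unshelve. all: by end_near. Qed.

Section L2complete.
Context {R : realType} {I : finType}.

Fact l2_complete (F : set_system (l2 R I)) : ProperFilter F -> cauchy F -> cvg F.
Proof.
move=> FF /cauchy_ballP Fc.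
have Fi i : cvg ((fun u : l2 R I => u i : R[i]^o) @ F).
  apply: complex_complete; apply/cauchy_ballP => e e0.
  have [//|[A B] /= [FA FB] AB] := Fc e.
  exists ((fun u : l2 R I => u i : R[i]^o) @` A, (fun u : l2 R I => u i : R[i]^o) @` B) => /=.
    by split; [apply: filterS FA | apply: filterS FB] => x Ax; exists x.
  move=> [_ _] /= [[x Ax <-] [y By <-]].
  have := AB (x, y) (conj Ax By); rewrite -!ball_normE /= => xy.
  by apply: le_lt_trans xy; have := l2_coord (x - y) i; rewrite !ffunE.
pose l : l2 R I := [ffun i => lim ((fun u : l2 R I => u i : R[i]^o) @ F)].
apply/cvg_ex; exists l; apply/cvgrPdist_le => e e0.
(* Adding 1 to [#|I|] keeps the denominator nonzero when [I] is empty. *)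
have : \forall u \near F, forall i, `|l i - (u : l2 R I) i| <= e / (#|I|%:R + 1).
  apply: filter_forall => i; rewrite /l ffunE.
  have /cvgrPdist_le := Fi i; apply.
  by rewrite divr_gt0 // ltr_wpDl.
apply: filterS => u ule; apply: le_trans (l2_norm_sum _) _.
have : \sum_i `|(l - u) i| <= \sum_(i : I) e / (#|I|%:R + 1).
  by apply: ler_sum => i _; apply: le_trans (ule i); rewrite !ffunE.
move=> /le_trans; apply; rewrite sumr_const -[leLHS]mulr_natr.
rewrite -mulrA ler_piMr ?(ltW e0) // mulrC.
by rewrite ler_pdivrMr ?mul1r ?lerDl // ltr_wpDl.
Qed.

HB.instance Definition _ := Uniform_isComplete.Build (l2 R I) l2_complete.

Fact l2dot_norm (v : l2 R I) : l2dot v v = `|v| ^+ 2.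
Proof. by rewrite l2_normE sqrtCK. Qed.

Definition l2_hilbert : hilbertSpace R :=
  @HilbertSpace R (l2 R I) (l2dot : {dot l2 R I for Num.conj}) l2dot_norm.

End L2complete.

(** * Forms and graphs of bounded operators *)

Section Forms.
Context {R : realType} {H : hilbertSpace R}.
Local Notation C := R[i].
Implicit Types (u v w : H) (c : C).

Lemma dotDl u v w : '[u + v, w] = '[u, w] + '[v, w].
Proof. exact: linearDl. Qed.

Lemma dotDr u v w : '[u, v + w] = '[u, v] + '[u, w].
Proof. exact: linearDr. Qed.

Lemma dotZl c u v : '[c *: u, v] = c * '[u, v].
Proof. exact: linearZl_LR. Qed.

Lemma dotZr c u v : '[u, c *: v] = c^* * '[u, v].
Proof. exact: linearZr_LR. Qed.

Lemma dot0l u : '[0, u] = 0. Proof. exact: linear0l. Qed.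
Lemma dot0r u : '[u, 0] = 0. Proof. exact: linear0r. Qed.

Lemma dotBl u v w : '[u - v, w] = '[u, w] - '[v, w].
Proof. exact: linearBl. Qed.

Lemma dot_suml (K : Type) (r : seq K) (P : pred K) (F : K -> H) v :
  '[\sum_(k <- r | P k) F k, v] = \sum_(k <- r | P k) '[F k, v].
Proof. exact: linear_sumlz. Qed.

Lemma dot_sumr (K : Type) (r : seq K) (P : pred K) (F : K -> H) v :
  '[v, \sum_(k <- r | P k) F k] = \sum_(k <- r | P k) '[v, F k].
Proof. exact: linear_sumr. Qed.

Lemma dotC u v : '[u, v] = '[v, u]^*.
Proof. by rewrite hermC expr0 mul1r. Qed.

Lemma dot_ge0 u : 0 <= '[u, u]. Proof. exact: dnorm_ge0. Qed.

Lemma dot_eq0 u : '[u, u] = 0 -> u = 0.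
Proof. by move=> /eqP; rewrite dnorm_eq0 => /eqP. Qed.

Lemma dot_inj u v : (forall w, '[u, w] = '[v, w]) -> u = v.
Proof.
move=> uv; apply/eqP; rewrite -subr_eq0; apply/eqP/dot_eq0.
by rewrite dotBl uv subrr.
Qed.

Lemma sqr_i4 : ('i ^+ 2 = -1 :> C) * ('i ^+ 3 = - 'i :> C).
Proof. by split; rewrite ?exprS ?expr0 ?mulr1 -?expr2 sqrCi ?mulrN1. Qed.

(** The left side has the shape of the formula in [spm_integral], so this identity reads that
    formula as a matrix coefficient. *)
Lemma polarization (S : H -> H) u v : linear S ->
  4^-1 * \sum_(k < 4) 'i ^+ k * '[S (v + 'i ^+ k *: u), v + 'i ^+ k *: u] =
  '[S v, u].
Proof.
move=> Slin.
have SE c x y : S (x + c *: y) = S x + c *: S y.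
  by rewrite addrC Slin addrC.
rewrite !big_ord_recr big_ord0 /= !SE !dotDl !dotDr !dotZl !dotZr.
have conjNi : (- 'i)^* = 'i :> C by rewrite rmorphN /= conjCi opprK.
rewrite !sqr_i4 !expr0 expr1 !conjNi !(rmorphN, rmorph1, conjCi).
apply: (mulfI (_ : 4 != 0)); first by rewrite pnatr_eq0.
rewrite mulrA divff ?pnatr_eq0 // mul1r.
have i2 : 'i * 'i = -1 :> C by rewrite -expr2 sqrCi.
set x := '[S v, v]; set y := '[S v, u]; set z := '[S u, v]; set t := '[S u, u].
by ring: i2.
Qed.

Lemma op_eq0 (S : H -> H) : linear S -> (forall v, '[S v, v] = 0) -> S = 0.
Proof.
move=> Slin S0; apply/funext => v; apply: dot_inj => u.
rewrite -(polarization _ _ Slin) big1 ?mulr0 ?dot0l // => k _.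
by rewrite S0 mulr0.
Qed.

Lemma op_eq (S T : H -> H) : linear S -> linear T ->
  (forall v, '[S v, v] = '[T v, v]) -> S = T.
Proof.
move=> Sl Tl ST; apply/eqP; rewrite -subr_eq0; apply/eqP.
apply: op_eq0 => [c u v|v]; rewrite !fctE ?Sl ?Tl; last by rewrite dotBl ST subrr.
by rewrite scalerBr opprD addrACA.
Qed.

End Forms.

Section Operators.
Context {R : realType} {H : hilbertSpace R}.
Local Notation C := R[i].
Implicit Types (S T : H -> H) (c : C).

Lemma linear_op0 T : linear T -> T 0 = 0.
Proof. by move=> /(_ (-1) 0 0); rewrite scaler0 addr0 scaleN1r addNr. Qed.

Lemma linear_opD T u v : linear T -> T (u + v) = T u + T v.
Proof. by move=> Tl; rewrite -[u]scale1r Tl !scale1r. Qed.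

Lemma linear_opZ T c u : linear T -> T (c *: u) = c *: T u.
Proof. by move=> Tl; rewrite -[_ *: u]addr0 Tl linear_op0 ?addr0. Qed.

Lemma linear_op_sum T (K : Type) (r : seq K) (P : pred K) (F : K -> H) :
  linear T -> T (\sum_(k <- r | P k) F k) = \sum_(k <- r | P k) T (F k).
Proof.
move=> Tl; apply: (big_morph T) => [u v|]; first exact: linear_opD.
exact: linear_op0.
Qed.

Lemma bounded_op0 : bounded_op (0 : H -> H).
Proof.
split=> [c u v|]; first by change (0 = c *: (0 : H) + 0); rewrite scaler0 addr0.
exact: cst_continuous.
Qed.

Lemma bounded_op_id : bounded_op (idfun : H -> H).
Proof. by split=> // v; exact: cvg_id. Qed.

Lemma bounded_opZD c S T : bounded_op S -> bounded_op T ->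
  bounded_op (c *: S + T).
Proof.
move=> [Sl Sc] [Tl Tc]; split=> [a u v|v].
  rewrite !fctE Sl Tl !scalerDr !scalerA addrACA; congr (_ + _).
  by rewrite mulrC.
by apply: cvgD; [apply: cvgZl_tmp; exact: Sc | exact: Tc].
Qed.

Lemma bounded_opD S T : bounded_op S -> bounded_op T -> bounded_op (S + T).
Proof. by move=> bS /(bounded_opZD 1 bS); rewrite scale1r. Qed.

Lemma bounded_opZ c S : bounded_op S -> bounded_op (c *: S).
Proof. by move=> /(bounded_opZD c)/(_ bounded_op0); rewrite addr0. Qed.

Lemma bounded_opB S T : bounded_op S -> bounded_op T -> bounded_op (S - T).
Proof.
by move=> bS bT; have := bounded_opZD (-1) bT bS; rewrite scaleN1r addrC.
Qed.

Lemma bounded_op_sum (K : Type) (r : seq K) (P : pred K) (F : K -> H -> H) :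
  (forall k, bounded_op (F k)) -> bounded_op (\sum_(k <- r | P k) F k).
Proof.
move=> bF; elim/big_ind: _ => //; first exact: bounded_op0.
by move=> S T; exact: bounded_opD.
Qed.

Lemma bounded_op_comp S T : bounded_op S -> bounded_op T -> bounded_op (S \o T).
Proof.
move=> [Sl Sc] [Tl Tc]; split=> [a u v|v]; first by rewrite /= Tl Sl.
by apply: continuous_comp; [exact: Tc | exact: Sc].
Qed.

Lemma closed_op_graph T : bounded_op T -> closed (op_graph T).
Proof.
move=> [_ Tc].
rewrite (_ : op_graph T = (fun p : H * H => p.2 - T p.1) @^-1` [set 0]); last first.
  apply/seteqP; split=> -[u v] /=; rewrite /op_graph /=; first by move=> ->; rewrite subrr.
  by move=> /eqP; rewrite subr_eq0 => /eqP.
apply: closed_comp; last first.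
  exact: accessible_closed_set1 (hausdorff_accessible (@norm_hausdorff _ H)) _.
move=> p _; apply: cvgB; first exact: cvg_snd.
by apply: (@continuous_comp _ _ _ fst T); [exact: cvg_fst|exact: Tc].
Qed.

Lemma op_dom_graph T : op_dom (op_graph T) = setT.
Proof. by apply/seteqP; split=> // u _; exists (u, T u). Qed.

Lemma closed_operator_graph T : bounded_op T -> closed_operator (op_graph T).
Proof.
move=> bT; split.
- by move=> v w w'; rewrite /op_graph /= => -> ->.
- by move=> c p q; rewrite /op_graph /= => -> ->; rewrite bT.1.
- exact: closed_op_graph.
- by rewrite op_dom_graph => U [x Ux] _; exists x.
Qed.

Lemma adjoint_op_graph T : is_adjoint T T -> adjoint_graph (op_graph T) = op_graph T.
Proof.
move=> Ta; apply/seteqP; split=> -[u v]; rewrite /adjoint_graph /op_graph /=.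
  move=> uv; apply: dot_inj => w; rewrite dotC [RHS]dotC -Ta.
  by rewrite -(uv (w, T w)).
by move=> -> [x y] /= ->; rewrite Ta.
Qed.

Lemma self_adjoint_op_graph T : bounded_op T -> is_adjoint T T ->
  self_adjoint (op_graph T).
Proof.
by move=> bT aT; split; [exact: closed_operator_graph | exact: adjoint_op_graph].
Qed.

Lemma graph_comp_op_graph S T :
  graph_comp (op_graph S) (op_graph T) = op_graph (S \o T).
Proof.
apply/seteqP; split=> -[u v]; rewrite /graph_comp /op_graph /=.
  by move=> [w -> ->].
by move=> ->; exists (T u).
Qed.

Lemma strong_add_op_graph S T : bounded_op S -> bounded_op T ->
  strong_add (op_graph S) (op_graph T) = op_graph (S + T).
Proof.
move=> bS bT; rewrite [RHS](closure_id _).1; last first.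
  by apply: closed_op_graph; exact: bounded_opD.
congr closure; apply/seteqP; split=> -[u v]; rewrite /op_graph /=.
  by move=> [_ [_ [-> -> ->]]].
by move=> ->; exists (S u), (T u).
Qed.

Lemma strong_sub_op_graph S T : bounded_op S -> bounded_op T ->
  strong_sub (op_graph S) (op_graph T) = op_graph (S - T).
Proof.
move=> bS bT; rewrite [RHS](closure_id _).1; last first.
  by apply: closed_op_graph; exact: bounded_opB.
congr closure; apply/seteqP; split=> -[u v]; rewrite /op_graph /=.
  by move=> [_ [_ [-> -> ->]]].
by move=> ->; exists (S u), (T u).
Qed.

Lemma op_graph_inj S T : op_graph S = op_graph T -> S = T.
Proof.
move=> ST; apply/funext => u.
by have : op_graph S (u, S u) by []; rewrite ST.
Qed.

Lemma is_adjointD S T S' T' : is_adjoint S S' -> is_adjoint T T' ->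
  is_adjoint (S + T) (S' + T').
Proof. by move=> aS aT u v; rewrite dotDl dotDr aS aT. Qed.

Lemma is_adjointZ c S S' : is_adjoint S S' -> is_adjoint (c *: S) (c^* *: S').
Proof. by move=> aS u v; rewrite dotZl dotZr aS conjCK. Qed.

Lemma is_adjoint_sum (K : Type) (r : seq K) (P : pred K) (F F' : K -> H -> H) :
  (forall k, is_adjoint (F k) (F' k)) ->
  is_adjoint (\sum_(k <- r | P k) F k) (\sum_(k <- r | P k) F' k).
Proof.
move=> aF u v; rewrite !fct_sumE dot_suml dot_sumr.
by apply: eq_bigr => k _; exact: aF.
Qed.

Lemma is_adjoint_comp S T S' T' : is_adjoint S S' -> is_adjoint T T' ->
  is_adjoint (S \o T) (T' \o S').
Proof. by move=> aS aT u v; rewrite /= aS aT. Qed.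

End Operators.

(** * Uniqueness of the spectral measure *)

Section DiscreteMeasure.
Context {R : realType} {K : finType} (c : K -> {nonneg R}) (x : K -> R).

(** [msum] takes measures indexed by [nat]: the elements of [K] are enumerated, and indices from
    [#|K|] on default to the zero measure. *)
Definition discrete_part (n : nat) : {measure set R -> \bar R} :=
  if insub n is Some i then
    mscale (c (@enum_val K xpredT i)) \d_(x (enum_val i))
  else mzero.

Definition discrete_measure : {measure set R -> \bar R} :=
  msum discrete_part #|K|.

Lemma discrete_partE (i : 'I_#|K|) :
  discrete_part i = mscale (c (@enum_val K xpredT i)) \d_(x (enum_val i)).
Proof. by rewrite /discrete_part valK. Qed.

Lemma discrete_measureE A :
  discrete_measure A = (\sum_k (c k)%:num * \1_A (x k))%:E.
Proof.
rewrite -sumEFin (reindex_onto (@enum_val K xpredT) enum_rank) /=; last first.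
  by move=> k _; exact: enum_rankK.
rewrite /discrete_measure /= /msum; apply: congr_big => // [i|i _].
  by rewrite enum_valK eqxx.
rewrite discrete_partE /= /mscale /=.
by rewrite diracE EFinM.
Qed.

Lemma ge0_integral_discrete (f : R -> R) : measurable_fun setT f ->
  (forall t, 0 <= f t) ->
  (\int[discrete_measure]_t (f t)%:E = (\sum_k (c k)%:num * f (x k))%:E)%E.
Proof.
move=> mf f0.
have mEf : measurable_fun setT (fun t => (f t)%:E) by exact/measurable_EFinP.
rewrite ge0_integral_measure_sum //; last by move=> t _; rewrite lee_fin.
rewrite -sumEFin [RHS](reindex_onto (@enum_val K xpredT) enum_rank) /=; last first.
  by move=> k _; exact: enum_rankK.
apply: congr_big => // [i|i _]; first by rewrite enum_valK eqxx.
rewrite discrete_partE ge0_integral_mscale //; last by move=> t _; rewrite lee_fin.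
by rewrite integral_dirac // diracT mul1e EFinM.
Qed.

Lemma integral_discrete (f : R -> R) : measurable_fun setT f ->
  (\int[discrete_measure]_t (f t)%:E = (\sum_k (c k)%:num * f (x k))%:E)%E.
Proof.
move=> mf; rewrite integralE.
have -> : ((fun t => (f t)%:E)^\+ = EFin \o (f^\+)%R)%E.
  by apply/funext => t; rewrite funeposE /= EFin_max.
have -> : ((fun t => (f t)%:E)^\- = EFin \o (f^\-)%R)%E.
  by apply/funext => t; rewrite funenegE /= EFin_max.
rewrite !ge0_integral_discrete //; last 2 first.
  exact: measurable_funrneg.
  exact: measurable_funrpos.
rewrite -EFinB -sumrB; congr EFin; apply: eq_bigr => k _.
rewrite -mulrBr; congr (_ * _).
by have := congr1 (fun g => g (x k)) (funrposBneg f); rewrite !fctE.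
Qed.

End DiscreteMeasure.

Section IntegralCombination.
Context {R : realType}.
Implicit Types (m : {measure set R -> \bar R}) (c : {nonneg R}).

Lemma integrable_mscale m c (f : R -> R) :
  m.-integrable setT (EFin \o f) -> (mscale c m).-integrable setT (EFin \o f).
Proof.
move=> /integrableP[mf intf]; apply/integrableP; split => //.
rewrite ge0_integral_mscale //; last exact: measurableT_comp.
by rewrite lte_mul_pinfty // lee_fin.
Qed.

Lemma integral_mscale m c (f : R -> R) : m.-integrable setT (EFin \o f) ->
  (\int[mscale c m]_t (f t)%:E = c%:num%:E * \int[m]_t (f t)%:E)%E.
Proof.
move=> intf; have mf := measurable_int _ intf.
rewrite integralE [in RHS]integralE muleBr //; last first.
  by apply: fin_num_adde_defr; apply: integrable_pos_fin_num.
rewrite !ge0_integral_mscale //; [exact: measurable_funeneg|exact: measurable_funepos].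
Qed.

Lemma Rintegral_measure_comb m m1 m2 c (f : R -> R) :
  (forall A, measurable A -> m A = m1 A + c%:num%:E * m2 A)%E ->
  m1.-integrable setT (EFin \o f) -> m2.-integrable setT (EFin \o f) ->
  Rintegral m setT f = Rintegral m1 setT f + c%:num * Rintegral m2 setT f.
Proof.
move=> mE int1 int2; rewrite /Rintegral.
rewrite (eq_measure_integral (measure_add m1 (mscale c m2))); last first.
  by move=> A mA _; rewrite mE // [RHS]measure_addE.
rewrite integral_measure_add //; last exact: integrable_mscale.
rewrite integral_mscale // fineD ?fineM ?fin_numM //.
all: by apply: integrable_fin_num.
Qed.

(** Since |t| <= t^2 + 1 and the measure is finite. This turns the square-integrability in [spm_dom]
    into integrability of t. *)
Lemma integrable_sqr m : (m setT < +oo)%E -> (\int[m]_t (t ^+ 2)%:E < +oo)%E ->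
  m.-integrable setT (EFin \o (id : R -> R)).
Proof.
move=> mfin sqfin.
apply: (@le_integrable _ _ _ m setT measurableT _ (fun t : R => ((t ^+ 2)%:E + 1%:E)%E)).
- exact/measurable_EFinP.
- move=> t _ /=; rewrite lee_fin.
  rewrite [leRHS]ger0_norm ?addr_ge0 ?sqr_ge0 // real_ler_norml ?num_real //.
  by nra.
apply: integrableD => //; apply/integrableP; split.
- by apply/measurable_EFinP; exact: exprn_measurable.
- by under eq_integral do rewrite /= ger0_norm ?sqr_ge0 //.
- exact/measurable_EFinP.
- by under eq_integral do rewrite /= normr1; rewrite integral_cst //= mul1e.
Qed.

End IntegralCombination.

Section SpectralMeasure.
Context {R : realType} {H : hilbertSpace R} (E : @spectral_measure R H).
Local Notation C := R[i].
Implicit Types (A B : set R) (u v w : H).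

Lemma projection_dot (P : H -> H) v :
  is_projection bounded_op P -> '[P v, v] = '[P v, P v].
Proof. by move=> [_ PP aP]; rewrite -aP -[P (P v)]/((P \o P) v) PP. Qed.

Lemma spm_linear A : measurable A -> linear (spm E A).
Proof. by move=> /(spm_proj E)[[]]. Qed.

Lemma spm_dot A B u v : measurable A -> measurable B ->
  '[spm E A u, spm E B v] = '[spm E (A `&` B) u, v].
Proof.
move=> mA mB; have [_ _ aB] := spm_proj E mB.
by rewrite -aB setIC spm_setI.
Qed.

Lemma spm_form_sqr v A : measurable A ->
  spm_form E v A = (complex.Re '[spm E A v, spm E A v])%:E.
Proof. by move=> mA; rewrite spm_formE // (projection_dot _ (spm_proj E mA)). Qed.

Lemma spm_formT v : spm_form E v setT = (complex.Re '[v, v])%:E.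
Proof. by rewrite spm_formE // spm_setT. Qed.

Lemma Re_dot_eq0 v : complex.Re '[v, v] = 0 -> v = 0.
Proof.
move=> v0; apply: dot_eq0; rewrite -[LHS]RRe_real ?v0 //.
by apply: ger0_real; exact: dot_ge0.
Qed.

Lemma spm_set0 v : spm E set0 v = 0.
Proof.
apply: Re_dot_eq0; have := spm_form_sqr v (@measurable0 _ _).
by rewrite measure0 => -[].
Qed.

Lemma dot_real (P : H -> H) v : is_adjoint P P -> '[P v, v] = (complex.Re '[P v, v])%:C.
Proof.
move=> aP; rewrite RRe_real // CrealE; apply/eqP.
by rewrite -dotC aP.
Qed.

(** A [spectral_measure] carries additivity only through its scalar measures; it passes to the
    operators because a quadratic form determines its operator. *)
Lemma spm_setC A v : measurable A -> spm E (~` A) v = v - spm E A v.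
Proof.
move=> mA; have mCA := measurableC mA.
have [[lA _] _ aA] := spm_proj E mA; have [[lCA _] _ aCA] := spm_proj E mCA.
apply: (congr1 (fun S : H -> H => S v) (_ : _ = idfun - spm E A)).
apply: op_eq => // [a x y|x].
  by rewrite !fctE lA scalerBr opprD addrACA.
rewrite !fctE dotBl (dot_real x aCA) (dot_real x aA).
rewrite -[X in X - _]RRe_real; last by apply: ger0_real; exact: dot_ge0.
rewrite -rmorphB; congr (_%:C); apply/esym/eqP; rewrite subr_eq; apply/eqP.
apply: EFin_inj; rewrite EFinD -spm_formT -(spm_formE E x mA) -(spm_formE E x mCA).
by rewrite addeC -measureU ?setICr // setUv.
Qed.

Lemma integrable_spm v : spm_dom E id v ->
  (spm_form E v).-integrable setT (EFin \o (id : R -> R)).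
Proof. by apply: integrable_sqr; rewrite spm_formT ltry. Qed.

Lemma spm_form_combination A v (c : C) (r : {nonneg R}) : measurable A ->
    c * c^* = r%:num%:C -> forall B, measurable B ->
  spm_form E (spm E (~` A) v + c *: spm E A v) B =
    (spm_form E (spm E (~` A) v) B + r%:num%:E * spm_form E (spm E A v) B)%E.
Proof.
move=> mA cr B mB; have mCA := measurableC mA.
have lB := spm_linear mB.
have orth : '[spm E B (spm E (~` A) v), spm E B (spm E A v)] = 0.
  rewrite -![spm E B _]/((spm E B \o _) v) -!spm_setI // spm_dot //; try exact: measurableI.
  rewrite (_ : _ `&` _ = set0) ?spm_set0 ?dot0l //.
  by apply/seteqP; split=> t //= -[[_ nAt] [_ At]].
rewrite !spm_form_sqr // -EFinM -EFinD (linear_opD _ _ lB) (linear_opZ _ _ lB).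
rewrite dotDl !dotDr !dotZl !dotZr. rewrite orth.
rewrite (dotC (spm E B (spm E A v)) (spm E B (spm E (~` A) v))).
rewrite orth conjC0 !mulr0 addr0 add0r mulrA cr.
congr (_%:E); rewrite -[X in _%:C * X]RRe_real; last by apply: ger0_real; exact: dot_ge0.
by rewrite -rmorphM; case: '[_, _].
Qed.

(* With w = E(A) v, orthogonality of E(A) v and E(~A) v gives
   <T v, w> = \int t dmu_w, hence \int (t - lam) dmu_w = 0; but mu_w is carried
   by A, where t - lam has a constant sign. *)
Lemma spm_eigen_side (T : H -> H) v (lam s : R) A :
  (forall u, spm_integral E id (u, T u)) -> T v = lam%:C *: v ->
  measurable A -> (forall t, A t -> 0 < s * (t - lam)) -> spm E A v = 0.
Proof.
move=> ET Tv mA sA; have mCA := measurableC mA.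
set w := spm E A v; set w' := spm E (~` A) v.
have vE : v = w' + w by rewrite /w' spm_setC // subrK.
pose I := Rintegral (spm_form E w) setT id.
pose J := Rintegral (spm_form E w') setT id.
have intw := integrable_spm (ET w).1.
have intw' := integrable_spm (ET w').1.
(* Here [v + c *: w] is [w' + (1 + c) *: w], and [r] is the squared modulus of [1 + c]. *)
have step (c : C) (r : {nonneg R}) : (1 + c) * (1 + c)^* = r%:num%:C ->
    Rintegral (spm_form E (v + c *: w)) setT id = J + r%:num * I.
  move=> cr; rewrite {1}vE -addrA -[X in _ + (X + _)]scale1r -scalerDl.
  by apply: Rintegral_measure_comb => // B mB; exact: spm_form_combination.
have Iv : '[T v, w] = I%:C.
  rewrite (ET v).2; last exact: (ET w).1.
  have i2 : 'i * 'i = -1 :> C by rewrite -expr2 sqrCi.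
  rewrite !big_ord_recr big_ord0 /= add0r !sqr_i4 expr0 expr1.
  (* The values 4, 2, 0, 2 are |1 + i^k|^2. The powers of ['i] sum to zero, so [J] cancels, and 4 +
     2i - 2i = 4 leaves exactly [I]. *)
  rewrite (step 1 4%:nng) ?(step 'i 2%:nng) ?(step (-1) 0%:nng) ?(step (- 'i) 2%:nng) /=.
  - rewrite !rmorphD !rmorphM /=.
    apply: (mulfI (_ : 4 != 0)); first by rewrite pnatr_eq0.
    rewrite mulrA divff ?pnatr_eq0 // mul1r.
    have -> : (2:R)%:C = 2 by rewrite rmorph_nat.
    have -> : (4:R)%:C = 4 by rewrite rmorph_nat.
    have -> : (0:R)%:C = 0 by [].
    by ring.
  - rewrite rmorphD rmorphN /= rmorph1 conjCi rmorph_nat; ring: i2.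
  - rewrite subrr mul0r; by [].
  - rewrite rmorphD /= rmorph1 conjCi rmorph_nat; ring: i2.
  - rewrite rmorphD /= rmorph1 rmorph_nat; by ring.
have vw : '[v, w] = '[w, w].
  by have [_ _ aA] := spm_proj E mA; rewrite -[LHS](aA v v) projection_dot //; exact: spm_proj.
have N_fin : spm_form E w setT = (complex.Re '[w, w])%:E by rewrite spm_formT.
have IE : I = lam * complex.Re '[w, w].
  apply: complexI; rewrite -Iv Tv dotZl vw rmorphM /=; congr (_ * _).
  by rewrite RRe_real //; apply: ger0_real; exact: dot_ge0.
have nullCA : spm_form E w (~` A) = 0%E.
  rewrite spm_form_sqr // /w -[spm E _ (spm E A v)]/((spm E _ \o spm E A) v) -spm_setI //.
  by rewrite setICl spm_set0 dot0l.
pose g t : R := s * (t - lam).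
have int1 : (spm_form E w).-integrable setT (EFin \o cst lam).
  apply/integrableP; split; first exact/measurable_EFinP.
  by rewrite /= integral_cst //= N_fin -EFinM ltry.
have intB : (spm_form E w).-integrable setT (EFin \o (fun t => t - lam)).
  by have := integrableB measurableT intw int1.
have intg : (spm_form E w).-integrable setT (EFin \o g).
  by have := integrableZl measurableT s intB.
have mg := measurable_int _ intg.
have g0 : (\int[spm_form E w]_t (g t)%:E = 0)%E.
  rewrite -[LHS]fineK ?integrable_fin_num // -[fine _]/(Rintegral _ _ _).
  rewrite RintegralZl // RintegralB // Rintegral_cst // N_fin -/I IE.
  by rewrite subrr mulr0.
(* Almost everywhere [g] is nonnegative, and its integral is zero, so it vanishes almost everywhere.
   Being positive on [A], it makes [A] a null set, like its complement; hence [w] has norm zero. *)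
have gpos : ae_eq (spm_form E w) setT (EFin \o g) (fun t => `|(g t)%:E|%E).
  exists (~` A); split => // t /= /not_implyP[_ gt] At; apply: gt.
  by rewrite ger0_norm // ltW // sA.
have gabs : ae_eq (spm_form E w) setT (EFin \o g) (cst 0%E).
  apply/(ae_eq_integral_abs _ measurableT mg); rewrite -g0.
  apply/esym/ae_eq_integral => //; exact: measurableT_comp.
have nullA : spm_form E w A = 0%E.
  apply/negligibleP => //; move: gabs; apply: negligibleS => t At /= gt.
  by have := sA t At; have /= [gt0] := gt Logic.I; rewrite -/(g t) gt0 ltxx.
apply: Re_dot_eq0; apply: EFin_inj.
rewrite -spm_formT -(setUv A) measureU ?setICr //.
by rewrite [X in (X + _)%E]nullA [X in (_ + X)%E]nullCA adde0.
Qed.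

End SpectralMeasure.

(** * Functional calculus of a finite spectral resolution *)

Section Resolution.
Context {R : realType} {H : hilbertSpace R} {K : finType} (P : K -> H -> H).
Local Notation C := R[i].
Implicit Types (c d lam : K -> R) (phi : R -> R) (v : H).

Definition resolution : Prop :=
  [/\ forall k, is_projection bounded_op (P k),
      forall j k, j != k -> forall v, P j (P k v) = 0
    & forall v, \sum_k P k v = v].

Definition spec_op c : H -> H := \sum_k (c k)%:C *: P k.

Lemma spec_opE c v : spec_op c v = \sum_k (c k)%:C *: P k v.
Proof. by rewrite /spec_op fct_sumE. Qed.

Hypothesis resP : resolution.

Lemma resolution_bounded k : bounded_op (P k).
Proof. by have [/(_ k)[]] := resP. Qed.

Lemma resolution_proj j k v : P j (P k v) = if j == k then P k v else 0.
Proof.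
have [prP ortP _] := resP; case: eqP => [->|/eqP/ortP//].
by have [_ PP _] := prP k; rewrite -[LHS]/((P k \o P k) v) PP.
Qed.

Lemma bounded_spec_op c : bounded_op (spec_op c).
Proof. by apply: bounded_op_sum => k; apply: bounded_opZ; exact: resolution_bounded. Qed.

Lemma linear_spec_op c : linear (spec_op c).
Proof. by have [] := bounded_spec_op c. Qed.

Lemma conj_realC (x : R) : x%:C^* = x%:C.
Proof. by apply: conj_Creal; rewrite complex_real. Qed.

Lemma spec_op_adjoint c : is_adjoint (spec_op c) (spec_op c).
Proof.
apply: is_adjoint_sum => k; rewrite -[X in is_adjoint _ (X *: _)]conj_realC.
by apply: is_adjointZ; have [/(_ k)[]] := resP.
Qed.

Lemma proj_spec_op c k v : P k (spec_op c v) = (c k)%:C *: P k v.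
Proof.
have [lP _] := resolution_bounded k.
rewrite spec_opE (linear_op_sum _ _ _ lP) (bigD1 k) //= big1 => [|j jk].
  by rewrite (linear_opZ _ _ lP) resolution_proj eqxx addr0.
by rewrite (linear_opZ _ _ lP) resolution_proj eq_sym (negbTE jk) scaler0.
Qed.

Lemma spec_op_proj c k v : spec_op c (P k v) = (c k)%:C *: P k v.
Proof.
rewrite spec_opE (bigD1 k) //= big1 => [|j jk].
  by rewrite resolution_proj eqxx addr0.
by rewrite resolution_proj (negbTE jk) scaler0.
Qed.

Lemma spec_op_comp c d : spec_op c \o spec_op d = spec_op (fun k => c k * d k).
Proof.
apply/funext => v /=; rewrite !spec_opE; apply: eq_bigr => k _.
by rewrite -spec_opE proj_spec_op scalerA rmorphM.
Qed.

Lemma spec_op1 : spec_op (fun=> 1) = idfun.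
Proof.
apply/funext => v; rewrite spec_opE; have [_ _ sumP] := resP.
by rewrite -[RHS]sumP; apply: eq_bigr => k _; rewrite scale1r.
Qed.

Definition weight v k : R := complex.Re '[P k v, P k v].

Lemma weightE v k : (weight v k)%:C = '[P k v, P k v].
Proof. by rewrite /weight RRe_real //; apply: ger0_real; exact: dot_ge0. Qed.

Lemma weight_ge0 v k : 0 <= weight v k.
Proof. by rewrite -ler0c weightE dot_ge0. Qed.

Lemma spec_op_dot c v : '[spec_op c v, v] = (\sum_k weight v k * c k)%:C.
Proof.
rewrite spec_opE dot_suml rmorph_sum; apply: eq_bigr => k _.
rewrite dotZl rmorphM /= weightE projection_dot; first by rewrite mulrC.
by have [] := resP.
Qed.

Lemma op_ge0_spec c : (forall k, 0 <= c k) -> op_ge0 (spec_op c).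
Proof.
move=> c0 v; rewrite spec_op_dot ler0c sumr_ge0 // => k _.
by rewrite mulr_ge0 ?weight_ge0.
Qed.

(** The point [l] cuts [A] into a right and a left part, and [spm_eigen_side] with [s = 1] and
    [s = -1] kills both. *)
Lemma spm_eigen (E : @spectral_measure R H) (T : H -> H) v (l : R) A :
  (forall u, spm_integral E id (u, T u)) -> T v = l%:C *: v ->
  measurable A -> ~ A l -> spm E A v = 0.
Proof.
move=> ET Tv mA nAl; apply: Re_dot_eq0; apply: EFin_inj.
rewrite -spm_form_sqr //.
have mA1 : measurable (A `&` `]l, +oo[%classic) by apply: measurableI.
have mA2 : measurable (A `&` `]-oo, l[%classic) by apply: measurableI.
have e1 : spm_form E v (A `&` `]l, +oo[%classic) = 0%E.
  rewrite spm_form_sqr // (spm_eigen_side (s := 1) ET Tv mA1) ?dot0l // => t [_ /=].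
  by rewrite in_itv /= andbT mul1r subr_gt0.
have e2 : spm_form E v (A `&` `]-oo, l[%classic) = 0%E.
  rewrite spm_form_sqr // (spm_eigen_side (s := -1) ET Tv mA2) ?dot0l // => t [_ /=].
  by rewrite in_itv /= mulN1r opprB subr_gt0.
have -> : A = (A `&` `]l, +oo[%classic) `|` (A `&` `]-oo, l[%classic).
  rewrite -setIUr; apply/seteqP; split => t; last by case.
  move=> At; split=> //=; rewrite !in_itv /= andbT.
  by have [lt|lt|lt] := ltgtP t l; [right|left|move: nAl; rewrite -lt].
rewrite measureU //; last first.
  apply/seteqP; split => t //= -[[_ +] [_ +]]; rewrite !in_itv /= andbT.
  by move=> /lt_trans/[apply]; rewrite ltxx.
by rewrite [X in (X + _)%E]e1 [X in (_ + X)%E]e2 adde0.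
Qed.

(** Uniqueness of the spectral measure: [P k v] is an eigenvector for [lam k], so [spm E A] kills it
    if [lam k] is outside [A], and fixes it otherwise, by the same argument for the complement. *)
Lemma spm_spec_op (E : @spectral_measure R H) lam A v :
  (forall u, spm_integral E id (u, spec_op lam u)) -> measurable A ->
  spm E A v = spec_op (fun k => \1_A (lam k)) v.
Proof.
move=> ET mA; have [_ _ sumP] := resP.
rewrite -{1}(sumP v) (linear_op_sum _ _ _ (spm_linear E mA)) spec_opE.
apply: eq_bigr => k _; rewrite indicE.
have [/set_mem Ak|nAk] := boolP (lam k \in A); last first.
  rewrite scale0r; apply: (spm_eigen ET (spec_op_proj _ _ _)) => //.
  by move/mem_set; exact/negP.
rewrite scale1r; apply/eqP; rewrite eq_sym -subr_eq0 -spm_setC //; apply/eqP.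
by apply: (spm_eigen ET (spec_op_proj _ _ _)); [exact: measurableC|apply].
Qed.

Lemma spm_form_spec (E : @spectral_measure R H) lam (phi : R -> R) v :
  (forall A u, measurable A -> spm E A u = spec_op (fun k => \1_A (lam k)) u) ->
  measurable_fun setT phi ->
  (\int[spm_form E v]_t (phi t)%:E = (\sum_k weight v k * phi (lam k))%:E)%E.
Proof.
move=> EA mphi.
rewrite (eq_measure_integral (discrete_measure (fun k => NngNum (weight_ge0 v k)) lam)).
  by rewrite integral_discrete.
move=> A mA _; rewrite [RHS]discrete_measureE spm_formE // EA // spec_op_dot.
by [].
Qed.

Lemma spm_integral_spec (E : @spectral_measure R H) lam phi :
  (forall A u, measurable A -> spm E A u = spec_op (fun k => \1_A (lam k)) u) ->
  measurable_fun setT phi ->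
  spm_integral E phi = op_graph (spec_op (phi \o lam)).
Proof.
move=> EA mphi.
have domE u : spm_dom E phi u.
  rewrite /spm_dom /= (spm_form_spec _ (phi := fun t => phi t ^+ 2) EA) ?ltry //.
  exact: measurable_funX.
have key v u : 4^-1 * \sum_(k < 4) 'i ^+ k *
    (\int[spm_form E (v + 'i ^+ k *: u)]_t phi t)%:C = '[spec_op (phi \o lam) v, u].
  rewrite -(polarization _ _ (linear_spec_op _)); congr (_ * _).
  apply: eq_bigr => k _; congr (_ * _).
  by rewrite spec_op_dot /Rintegral (spm_form_spec _ EA).
apply/seteqP; split=> -[v w] /=; rewrite /spm_integral /op_graph /=.
  by move=> [_ vw]; apply: dot_inj => u; rewrite vw ?key.
by move=> ->; split=> // u _; rewrite key.
Qed.

End Resolution.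

Section BorelCalculus.
Context {R : realType} {H : hilbertSpace R} {K : finType} {P : K -> H -> H}.
Hypothesis resP : resolution P.
Implicit Types (c lam : K -> R) (phi : R -> R).

Lemma spec_op_indic_proj lam (A : set R) :
  is_projection bounded_op (spec_op P (fun k => \1_A (lam k))).
Proof.
split; [exact: bounded_spec_op | | exact: spec_op_adjoint].
rewrite spec_op_comp //; congr spec_op; apply/funext => k.
by rewrite indicE -natrM mulnb andbb.
Qed.

Lemma spec_op_indicT lam : spec_op P (fun k => \1_setT (lam k)) = idfun.
Proof.
by rewrite -(spec_op1 resP); congr spec_op; apply/funext => k; rewrite indicT.
Qed.

Lemma spec_op_indicI lam (A B : set R) :
  spec_op P (fun k => \1_(A `&` B) (lam k)) =
    spec_op P (fun k => \1_A (lam k)) \o spec_op P (fun k => \1_B (lam k)).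
Proof.
by rewrite spec_op_comp //; congr spec_op; apply/funext => k; rewrite indicI.
Qed.

Lemma spec_form lam v A :
  discrete_measure (fun k => NngNum (weight_ge0 P v k)) lam A =
    (complex.Re '[spec_op P (fun k => \1_A (lam k)) v, v])%:E.
Proof. by rewrite discrete_measureE spec_op_dot. Qed.

(** Existence, as the witness for [borel_calc]. Its scalar measure at [v] puts mass |P k v|^2 at
    each [lam k]. *)
Definition spec_measure lam : @spectral_measure R H :=
  SpectralMeasure (fun A _ => spec_op_indic_proj lam A) (spec_op_indicT lam)
    (fun A B _ _ => spec_op_indicI lam A B) (fun v A _ => spec_form lam v A).

(** One inclusion is uniqueness of the spectral measure, the other its existence. From here on, the
    functional calculus is composition with the eigenvalue function. *)
Lemma borel_calc_spec lam phi : measurable_fun setT phi ->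
  borel_calc phi (op_graph (spec_op P lam)) = op_graph (spec_op P (phi \o lam)).
Proof.
move=> mphi; apply/seteqP; split => p.
  move=> [E EG]; rewrite (spm_integral_spec resP (lam := lam) _ mphi) //.
  move=> A u mA; apply: spm_spec_op => // w.
  by rewrite -[spm_integral _ _]/(spm_integral E (fun t => t)) EG.
move=> Gp; exists (spec_measure lam); last first.
  by rewrite (spm_integral_spec resP (lam := lam) _ mphi).
by rewrite (spm_integral_spec resP (lam := lam) (phi := id)).
Qed.

Lemma modulus_spec lam :
  modulus (op_graph (spec_op P lam)) = op_graph (spec_op P (fun k => `|lam k|)).
Proof.
rewrite /modulus adjoint_op_graph; last exact: spec_op_adjoint.
rewrite graph_comp_op_graph spec_op_comp // borel_calc_spec; last first.
  by apply: continuous_measurable_fun; exact: sqrt_continuous.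
by congr (op_graph (spec_op _ _)); apply/funext => k /=; rewrite -expr2 sqrtr_sqr.
Qed.

Lemma spectral_projection_spec (A : set R) lam : measurable A ->
  spectral_projection A (op_graph (spec_op P lam)) =
    op_graph (spec_op P (fun k => \1_A (lam k))).
Proof. by move=> mA; rewrite /spectral_projection borel_calc_spec. Qed.

Lemma modulus_powR_spec lam (p : R) :
  borel_calc (fun t => t `^ p) (modulus (op_graph (spec_op P lam))) =
    op_graph (spec_op P (fun k => `|lam k| `^ p)).
Proof. by rewrite modulus_spec borel_calc_spec //; exact: measurable_powR. Qed.

Lemma trace_ext_spec (M : set (H -> H)) tau c : (forall k, 0 <= c k) ->
  trace_ext M tau (op_graph (spec_op P c)) =
    ereal_sup [set tau T | T in [set T | pos_part M T /\
      exists n : nat, T = spec_op P (fun k => c k * \1_(`[0, n%:R]) (c k))]].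
Proof.
move=> c0; rewrite /trace_ext; congr (ereal_sup (_ @` _)).
have mphi (n : nat) : measurable_fun setT (fun t : R => t * \1_(`[0, n%:R]) t).
  by apply: measurable_funM => //; exact: measurable_indic.
apply/seteqP; split=> T [MT [n Tn]]; split => //; exists n.
  by apply: op_graph_inj; rewrite Tn borel_calc_spec.
by rewrite Tn borel_calc_spec.
Qed.

Lemma trace_ext0 (M : set (H -> H)) tau : M 0 -> tau 0 = 0%E ->
  trace_ext M tau (op_graph (spec_op P (fun=> 0))) = 0%E.
Proof.
move=> M0 tau0; rewrite trace_ext_spec //.
have spec0 (n : nat) : spec_op P (fun=> 0 * \1_(`[0, n%:R]) (0 : R)) = 0.
  apply/funext => v; rewrite spec_opE big1 // => k _.
  by rewrite mul0r scale0r.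
rewrite (_ : [set tau T | T in _] = [set 0%E]) ?ereal_sup1 //.
apply/seteqP; split=> [_ [T [_ [n ->]] <-]|_ ->] /=; first by rewrite spec0.
exists 0 => //; split; last by exists 0%N; rewrite spec0.
by split => // v; rewrite dot0l.
Qed.

End BorelCalculus.

Section ZeroOperator.
Context {R : realType} {H : hilbertSpace R}.

(** With this one-element resolution the zero operator becomes a [spec_op], so its norms follow from
    the general calculus. *)
Lemma resolution_id : resolution (fun _ : unit => (idfun : H -> H)).
Proof.
split=> [_|[] []//|v]; last by rewrite (bigD1 tt) //= big1 ?addr0 // => -[].
by split=> //; exact: bounded_op_id.
Qed.

Lemma Lp_norm0 (M : set (H -> H)) tau (p : R) : M 0 -> tau 0 = 0%E -> 0 < p ->
  Lp_norm M tau p (op_graph 0) = 0%E.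
Proof.
move=> M0 tau0 p0.
have spec0 : spec_op (fun _ : unit => (idfun : H -> H)) (fun=> 0) = 0.
  by apply/funext => v; rewrite spec_opE big1 // => k _; rewrite scale0r.
rewrite /Lp_norm -spec0 (modulus_powR_spec resolution_id).
under [X in spec_op _ X]eq_fun do rewrite normr0 powR0 ?gt_eqF //.
by rewrite (trace_ext0 resolution_id) // poweR0r // invr_eq0 gt_eqF.
Qed.

(** Provides the L^1 component of every bounded operator when it is written as an element of L^1 +
    M. *)
Lemma L1_space0 (M : set (H -> H)) (tau : (H -> H) -> \bar R) :
  M idfun -> M 0 -> tau 0 = 0%E -> L1_space M tau (op_graph 0).
Proof.
move=> M1 M0 tau0; split; last by rewrite Lp_norm0.
split; first by apply: closed_operator_graph; exact: bounded_op0.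
  move=> U [[lU _] _] _ v w; rewrite /op_graph /= => ->.
  by rewrite -[(0 : H -> H) v]/(0 : H) (linear_op0 lU).
move=> e e0; exists idfun; split => //.
  by rewrite op_dom_graph.
by rewrite subrr tau0 lee_fin ltW.
Qed.

End ZeroOperator.

(** * Trace and normality in finite dimension *)

Section OrthonormalBasis.
Context {R : realType} {H : hilbertSpace R} {I : finType}.
Local Notation C := R[i].
Implicit Types (S T A : H -> H) (u v : H).

Definition orthonormal_basis (e : I -> H) : Prop :=
  (forall i j, '[e i, e j] = (i == j)%:R) /\
  forall v, v = \sum_i '[v, e i] *: e i.

Context (e : I -> H).
Hypothesis eP : orthonormal_basis e.

Lemma basis_norm i : `|e i| = 1.
Proof.
apply/eqP; rewrite -(@eqrXn2 _ 2) // expr1n -hdot_norm eP.1 eqxx //.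
Qed.

Lemma dot_basis u v : '[u, v] = \sum_i '[u, e i] * '[e i, v].
Proof. by rewrite {1}(eP.2 u) dot_suml; apply: eq_bigr => i _; rewrite dotZl. Qed.

Lemma coord_norm v i : `|'[v, e i]| <= `|v|.
Proof.
rewrite -(@ler_pXn2r _ 2) ?nnegrE // -hdot_norm [leRHS]dot_basis (bigD1 i) //=.
rewrite (dotC (e i)).
rewrite -normCK lerDl sumr_ge0 // => j _.
by rewrite (dotC (e j)) -normCK exprn_ge0.
Qed.

Lemma norm_le_coord v : `|v| <= \sum_i `|'[v, e i]|.
Proof.
rewrite {1}(eP.2 v) (le_trans (ler_norm_sum _ _ _)) //; apply: ler_sum => i _.
by rewrite normrZ basis_norm mulr1.
Qed.

Lemma basis_bounded T : linear T -> bounded_op T.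
Proof.
move=> Tl; split=> // v; apply/cvgrPdist_le => eps eps0.
pose k := 1 + \sum_i `|T (e i)|.
have k0 : 0 < k by rewrite ltr_pwDl // sumr_ge0.
have Tk u : `|T u| <= `|u| * k.
  rewrite {1}(eP.2 u) (linear_op_sum _ _ _ Tl) (le_trans (ler_norm_sum _ _ _)) //.
  rewrite mulrDr mulr1 mulr_sumr ler_wpDl //; apply: ler_sum => i _.
  by rewrite /= (linear_opZ _ _ Tl) normrZ ler_wpM2r // coord_norm.
near=> u.
have -> : T v - T u = T (v - u).
  by rewrite (linear_opD _ _ Tl) -[in RHS]scaleN1r (linear_opZ _ _ Tl) scaleN1r.
rewrite (le_trans (Tk _)) // -ler_pdivlMr //.
by near: u; apply: cvgr_dist_le => //; rewrite divr_gt0.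
Unshelve. all: by end_near. Qed.

Definition ctrace T : C := \sum_i '[T (e i), e i].

Definition rtrace T : R := complex.Re (ctrace T).

Lemma ctraceD S T : ctrace (S + T) = ctrace S + ctrace T.
Proof. by rewrite /ctrace -big_split; apply: eq_bigr => i _; exact: dotDl. Qed.

Lemma ctraceZ c T : ctrace (c *: T) = c * ctrace T.
Proof. by rewrite /ctrace mulr_sumr; apply: eq_bigr => i _; exact: dotZl. Qed.

Lemma ctraceC S T : linear S -> linear T -> ctrace (S \o T) = ctrace (T \o S).
Proof.
move=> Sl Tl; rewrite /ctrace.
have compE U V i : linear U ->
    '[(U \o V) (e i), e i] = \sum_j '[V (e i), e j] * '[U (e j), e i].
  move=> Ul; rewrite /= {1}(eP.2 (V (e i))) (linear_op_sum _ _ _ Ul) dot_suml.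
  by apply: eq_bigr => j _; rewrite (linear_opZ _ _ Ul) dotZl.
under eq_bigr do rewrite compE //; under [RHS]eq_bigr do rewrite compE //.
rewrite exchange_big; apply: eq_bigr => i _; apply: eq_bigr => j _.
by rewrite mulrC.
Qed.

Lemma rtraceD S T : rtrace (S + T) = rtrace S + rtrace T.
Proof. by rewrite /rtrace ctraceD; case: (ctrace S) (ctrace T) => [? ?] []. Qed.

Lemma rtraceZ (c : R) T : rtrace (c%:C *: T) = c * rtrace T.
Proof.
by rewrite /rtrace ctraceZ; case: (ctrace T) => a b; rewrite /= mul0r subr0.
Qed.

Lemma rtraceB S T : rtrace (S - T) = rtrace S - rtrace T.
Proof.
have -> : S - T = S + (-1)%:C *: T by rewrite rmorphN rmorph1 scaleN1r.
by rewrite rtraceD rtraceZ mulN1r.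
Qed.

Lemma rtrace0 : rtrace 0 = 0.
Proof. by rewrite -(subrr (0 : H -> H)) rtraceB subrr. Qed.

Lemma ctrace_ge0 T : op_ge0 T -> 0 <= ctrace T.
Proof. by move=> T0; rewrite sumr_ge0 // => i _; exact: T0. Qed.

Lemma rtraceE T : op_ge0 T -> (rtrace T)%:C = ctrace T.
Proof. by move=> T0; rewrite RRe_real // ger0_real // ctrace_ge0. Qed.

Lemma rtrace_ge0 T : op_ge0 T -> 0 <= rtrace T.
Proof. by move=> T0; rewrite -ler0c rtraceE // ctrace_ge0. Qed.

Lemma rtrace_le S T : op_le S T -> rtrace S <= rtrace T.
Proof. by rewrite /op_le => /rtrace_ge0; rewrite rtraceB subr_ge0. Qed.

Let K : C := 2 ^+ #|I|.

(** A positive form obeys q(u + w) <= 2 (q(u) + q(w)), the defect being q(u - w). Applied once per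
    basis vector, this gives the crude constant [K]. *)
Lemma form_le_trace T v : linear T -> op_ge0 T ->
  '[T v, v] <= K * `|v| ^+ 2 * ctrace T.
Proof.
move=> Tl T0.
have par u w : '[T (u + w), u + w] <= 2 * ('[T u, u] + '[T w, w]).
  rewrite -subr_ge0 (_ : _ - _ = '[T (u - w), u - w]) //.
  rewrite -(scaleN1r w) !(linear_opD _ _ Tl) (linear_opZ _ _ Tl).
  rewrite !dotDl !dotDr !dotZl !dotZr rmorphN rmorph1; ring.
have sum (r : seq I) (f : I -> H) :
    '[T (\sum_(i <- r) f i), \sum_(i <- r) f i] <=
      2 ^+ size r * \sum_(i <- r) '[T (f i), f i].
  elim: r => [|i r IH]; first by rewrite !big_nil dot0r mulr0.
  rewrite !big_cons /= exprS (le_trans (par _ _)) // -mulrA ler_wpM2l //.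
  rewrite mulrDr lerD // ler_peMl ?T0 //.
  by rewrite exprn_ege1 // ler1n.
have sizeI : size (index_enum I) = #|I|.
  by rewrite -sum1_size -sum1_card; apply: eq_bigl.
rewrite {1 2}(eP.2 v) (le_trans (sum _ _)) // /K sizeI -mulrA ler_wpM2l ?exprn_ge0 //.
rewrite /ctrace mulr_sumr; apply: ler_sum => i _.
rewrite (linear_opZ _ _ Tl) dotZl dotZr mulrA -normCK ler_wpM2r ?T0 //.
by rewrite ler_pXn2r ?nnegrE // coord_norm.
Qed.

(** By polarization a coordinate of [T v] is an average of four values of the form, at vectors of
    norm at most |v| + 1. *)
Lemma norm_le_trace T v : linear T -> op_ge0 T ->
  `|T v| <= #|I|%:R * (K * (`|v| + 1) ^+ 2) * ctrace T.
Proof.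
move=> Tl T0; rewrite (le_trans (norm_le_coord _)) // -mulrA mulr_natl -sumr_const.
apply: ler_sum => i _; rewrite -(polarization _ _ Tl).
rewrite normrM normfV normr_nat ler_pdivrMl ?ltr0n // mulr_natl.
rewrite (le_trans (ler_norm_sum _ _ _)) // -[X in _ *+ X](card_ord 4) -sumr_const.
apply: ler_sum => k _.
rewrite normrM normrX normCi expr1n mul1r ger0_norm ?T0 //.
rewrite (le_trans (form_le_trace _ Tl T0)) // ler_wpM2r ?ctrace_ge0 //.
rewrite ler_wpM2l ?exprn_ge0 // ler_pXn2r ?nnegrE ?addr_ge0 //.
rewrite (le_trans (ler_normD _ _)) // normrZ normrX normCi expr1n mul1r.
by rewrite basis_norm.
Qed.

End OrthonormalBasis.

(** The nonnegative cone of [R[i]] is closed; since the order also asks for a zero imaginary part,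
    both parts are checked. It carries positivity of forms to limits. *)
Lemma complex_ge0_approx (R : realType) (x : R[i]) :
  (forall eps : R, 0 < eps -> exists2 y, 0 <= y & `|x - y| <= eps%:C) -> 0 <= x.
Proof.
move=> xy; rewrite lecE /= ; apply/andP; split.
  rewrite -normr_le0; apply/ler_addgt0Pr => eps eps0; rewrite add0r.
  have [y y0 xye] := xy eps eps0; rewrite -lecR (le_trans _ xye) //.
  apply: le_trans (normr_Im _); rewrite lecR.
  by case: x y y0 {xy xye} => [a b] [c d]; rewrite lecE /= => /andP[/eqP -> _]; rewrite subr0.
apply/ler_addgt0Pr => eps eps0; have [y y0 xye] := xy eps eps0.
have : `|complex.Re (x - y)|%:C <= eps%:C by exact: le_trans (normr_Re _) xye.
rewrite lecR ler_norml => /andP[+ _].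
case: x y y0 {xy xye} => [a b] [c d]; rewrite lecE /= => /andP[_ c0].
by rewrite lerBrDr; lra.
Qed.

(** The rate is that of operators whose traces miss a supremum by less than 1/(n+1), compared
    through a common upper bound. *)
Lemma cvgn_harmonic_cauchy (R : realType) (V : completeNormedModType R[i])
    (u : nat -> V) (c : R) : 0 <= c ->
  (forall n m, `|u n - u m| <= (c * (n.+1%:R^-1 + m.+1%:R^-1))%:C) -> cvgn u.
Proof.
move=> c0 ule; apply: cauchy_cvg; apply/cauchy_ballP => e e0.
have [eE eR0] : e = (complex.Re e)%:C /\ 0 < complex.Re e.
  by case: e e0 => x y; rewrite ltcE /= => /andP[/eqP -> x0]; split.
have d0 : 0 < complex.Re e / ((c + 1) * 2) by rewrite divr_gt0 // mulr_gt0 // ltr_wpDl.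
have [N _ HN] := near_infty_natSinv_lt (PosNum d0).
exists (u @` [set n | (N <= n)%N], u @` [set n | (N <= n)%N]) => /=.
  by split; exists N => // n /= Nn; exists n.
move=> [_ _] /= [[n Nn <-] [m Nm <-]]; rewrite -ball_normE /=.
rewrite (le_lt_trans (ule n m)) // eE ltcR.
have := HN n Nn; have := HN m Nm; rewrite /= => an am.
have cp : 0 < (c + 1) * 2 by rewrite mulr_gt0 // ltr_wpDl.
rewrite ltr_pdivlMr // in an; rewrite ltr_pdivlMr // in am.
have := invr_gt0 (n.+1%:R : R); have := invr_gt0 (m.+1%:R : R).
rewrite !ltr0n /=.
move: (n.+1%:R^-1 : R) (m.+1%:R^-1 : R) an am => p q pn qn p0 q0.
nra.
Qed.

(** * Suprema of directed families of positive operators *)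

Section Normality.
Context {R : realType} {H : hilbertSpace R} {I : finType} (e : I -> H).
Local Notation C := R[i].
Implicit Types (S T U : H -> H) (u v : H) (D : set (H -> H)).
Hypothesis eP : orthonormal_basis e.

Lemma dot_le_norm v : exists2 b : R, 0 <= b & forall u, `|'[u, v]| <= `|u| * b%:C.
Proof.
have b0 : 0 <= \sum_i `|'[e i, v]| by rewrite sumr_ge0.
exists (complex.Re (\sum_i `|'[e i, v]|)).
  by move: b0; rewrite lecE => /andP[].
move=> u; rewrite RRe_real ?ger0_real // (dot_basis eP) mulr_sumr.
rewrite (le_trans (ler_norm_sum _ _ _)) // ler_sum // => i _.
by rewrite normrM ler_wpM2r // coord_norm.
Qed.

Lemma norm_le_rtrace v : exists2 c : R, 0 <= c &
  forall T, linear T -> op_ge0 T -> `|T v| <= (c * rtrace e T)%:C.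
Proof.
set c : C := #|I|%:R * (2 ^+ #|I| * (`|v| + 1) ^+ 2).
have c0 : 0 <= c by rewrite !mulr_ge0 ?exprn_ge0 ?addr_ge0.
exists (complex.Re c); first by move: c0; rewrite lecE => /andP[].
move=> T Tl T0; rewrite rmorphM /= RRe_real ?ger0_real // rtraceE //.
exact: norm_le_trace.
Qed.

(* A sequence in D whose traces tend to their supremum converges strongly, since
   positive operators are bounded by their trace; its limit is an upper bound
   of D, hence lies above T. *)
Lemma directed_sup_trace D T : D `<=` pos_part bounded_op -> op_directed D ->
    op_sup bounded_op D T ->
  forall eps : R, 0 < eps -> exists2 S, D S & rtrace e (T - S) < eps.
Proof.
move=> Dpos [D0 Ddir] [Tpos Tub Tmin].
have Dl S : D S -> linear S by move=> /Dpos[[]].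
pose t := sup [set rtrace e S | S in D].
have tsup : has_sup [set rtrace e S | S in D].
  split; first by have [S DS] := D0; exists (rtrace e S); exists S.
  by exists (rtrace e T) => _ [S DS <-]; apply: rtrace_le; exact: Tub.
have tub S : D S -> rtrace e S <= t.
  by move=> DS; apply: sup_upper_bound => //; exists S.
have /choice [S_ S_P] : forall n, exists S, D S /\ t - n.+1%:R^-1 < rtrace e S.
  move=> n; have n0 : 0 < n.+1%:R^-1 :> R by rewrite invr_gt0.
  by have [_ [S DS <-] tS] := sup_adherent n0 tsup; exists S.
have S_D n := (S_P n).1; have S_t n := (S_P n).2.
(* The trace of [U] is at most [t], so [U - S_ n] is positive with trace below 1/(n+1), hence small
   at [v]. *)
have above n U v c : D U -> op_le (S_ n) U -> 0 <= c ->
    (forall T, linear T -> op_ge0 T -> `|T v| <= (c * rtrace e T)%:C) ->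
    `|U v - S_ n v| <= (c * n.+1%:R^-1)%:C.
  move=> DU SU c0 /(_ (U - S_ n)) le_c.
  have [Bl _] : bounded_op (U - S_ n).
    by apply: bounded_opB; [have [] := Dpos _ DU | have [] := Dpos _ (S_D n)].
  apply: le_trans (le_c Bl SU) _.
  rewrite lecR ler_wpM2l // rtraceB.
  by move: (n.+1%:R^-1) (tub _ DU) (S_t n) => d Ut St; lra.
have S_cvg v : cvgn (fun n => S_ n v).
  have [c c0 le_c] := norm_le_rtrace v.
  apply: (@cvgn_harmonic_cauchy _ _ _ c) => // n m.
  have [U [DU SnU SmU]] := Ddir _ _ (S_D n) (S_D m).
  have -> : S_ n v - S_ m v = (U v - S_ m v) - (U v - S_ n v).
    by rewrite opprB [RHS]addrC addrA subrK.
  rewrite (le_trans (ler_normB _ _)) // mulrDr rmorphD addrC /= lerD //; exact: above.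
pose T' v : H := limn (fun n => S_ n v).
have T'l : linear T'.
  move=> a u v; rewrite {1}/T'; apply: cvg_lim; first exact: norm_hausdorff.
  under eq_fun do rewrite (Dl _ (S_D _)).
  apply: cvgD; last exact: S_cvg.
  by apply: cvgZl_tmp; exact: S_cvg.
have T'b := basis_bounded eP T'l.
(* One index serves finitely many vectors at once; the trace estimate below needs the whole
   basis. *)
have T'approx (r : seq H) (eps : R) : 0 < eps -> exists n,
    n.+1%:R^-1 <= eps /\ {in r, forall v, `|T' v - S_ n v| <= eps%:C}.
  move=> eps0.
  have [n [an /allP Sn]] : exists n, n.+1%:R^-1 <= eps /\
      all (fun v => `|T' v - S_ n v| <= eps%:C) r.
    apply: (@filter_ex _ \oo); apply: filterI.
      have := near_infty_natSinv_lt (PosNum eps0); apply: filterS => n.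
      by rewrite /= => /ltW.
    elim: r => [|v r IH]; first exact: filterE.
    move: IH; apply: filterS2 => [n Sv Sr|].
      by apply/andP; split; [exact: Sv|exact: Sr].
    have /cvgrPdist_le := S_cvg v; apply; by rewrite ltcR.
  by exists n; split => // v /Sn.
(* Some [U] in [D] lies above both [S] and [S_ n]. It is close to [S_ n] at [v], hence to [T'], so
   the form of [T' - S] is approximated by that of [U - S], which is nonnegative. *)
have T'ub S : D S -> op_le S T'.
  move=> DS v; have [b b0 le_b] := dot_le_norm v; have [c c0 le_c] := norm_le_rtrace v.
  apply: complex_ge0_approx => eps eps0.
  have k0 : 0 < (1 + c) * b + 1 by rewrite ltr_wpDl // mulr_ge0 // addr_ge0.
  have [n [an Sn]] := T'approx [:: v] _ (divr_gt0 eps0 k0).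
  have [U [DU SU SnU]] := Ddir _ _ DS (S_D n).
  exists '[(U - S) v, v]; first exact: SU.
  rewrite -dotBl; have -> : (T' - S) v - (U - S) v = T' v - U v.
    by rewrite !fctE opprB addrA subrK.
  rewrite (le_trans (le_b _)) //.
  have : `|T' v - U v| <= ((1 + c) * (eps / ((1 + c) * b + 1)))%:C.
    have -> : T' v - U v = (T' v - S_ n v) - (U v - S_ n v).
      by rewrite opprB addrA subrK.
    rewrite (le_trans (ler_normB _ _)) // mulrDl mul1r rmorphD /= lerD //.
      by rewrite Sn ?mem_head.
    rewrite (le_trans (above _ _ _ _ DU SnU c0 le_c)) // lecR.
    by rewrite ler_wpM2l.
  move=> /(ler_wpM2r (_ : 0 <= b%:C)) -/(_ _); rewrite ler0c => /(_ b0) /le_trans; apply.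
  rewrite -rmorphM lecR mulrAC mulrA ler_pdivrMr //.
  by rewrite mulrC ler_pM2l //  lerDl.
have T'pos : pos_part bounded_op T'.
  split=> //; have [S DS] := D0; move=> v; rewrite -[T'](subrK S).
  by rewrite dotDl addr_ge0 ?T'ub //; have [_] := Dpos _ DS; exact.
have TT' : rtrace e T <= rtrace e T' by apply: rtrace_le; exact: Tmin.
have T't : rtrace e T' <= t.
  apply/ler_addgt0Pr => eps eps0.
  have k0 : 0 < #|I|%:R + 1 :> R by rewrite ltr_wpDl.
  have [n [_ Sn]] := T'approx (codom e) _ (divr_gt0 eps0 k0).
  rewrite -lerBlDl; apply: le_trans (_ : rtrace e T' - rtrace e (S_ n) <= _).
    by rewrite lerB // tub.
  rewrite -rtraceB.
  have : `|ctrace e (T' - S_ n)| <= eps%:C.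
    rewrite (le_trans (ler_norm_sum _ _ _)) //.
    apply: (@le_trans _ _ (\sum_(i : I) (eps / (#|I|%:R + 1))%:C)).
      apply: ler_sum => i _; rewrite (le_trans (coord_norm eP _ _)) //.
      by apply: Sn; exact: codom_f.
    rewrite sumr_const -raddfMn lecR -[leLHS]mulr_natr mulrAC ler_pdivrMr //.
    by rewrite ler_pM2l // lerDl.
  move=> /(le_trans (normr_Re _)); rewrite lecR; apply: le_trans.
  exact: ler_norm.
(* As tr T <= tr T' <= t, any [S] in [D] with trace above [t - eps] will do. *)
move=> eps eps0; have [_ [S DS <-] tS] := sup_adherent eps0 tsup.
exists S => //; rewrite rtraceB.
by rewrite -/t in tS; lra.
Qed.

End Normality.

(** * Commutants and averages over finite groups *)

Section Commutants.
Context {R : realType} {H : hilbertSpace R}.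
Implicit Types (A B : set (H -> H)) (S T : H -> H).

Lemma commutantS A B : A `<=` B -> commutant B `<=` commutant A.
Proof. by move=> AB T [bT TB]; split=> // S /AB; exact: TB. Qed.

Lemma sub_bicommutant A : A `<=` bounded_op -> A `<=` commutant (commutant A).
Proof. by move=> bA T AT; split=> [|S [_ SA]]; [exact: bA | rewrite SA]. Qed.

Lemma commutant_bounded A : commutant A `<=` bounded_op.
Proof. by move=> T []. Qed.

Lemma tricommutant A : A `<=` bounded_op ->
  commutant (commutant (commutant A)) = commutant A.
Proof.
move=> bA; apply/seteqP; split.
  by apply: commutantS; exact: sub_bicommutant.
by apply: sub_bicommutant; exact: commutant_bounded.
Qed.

Lemma bounded_op_bicommutant : commutant (commutant bounded_op) = bounded_op :> set (H -> H).
Proof.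
apply/seteqP; split; first exact: commutant_bounded.
exact: sub_bicommutant.
Qed.

(** [von_neumann] concerns every map adjoint to an element of the algebra, with no linearity
    presumed. Linearity is automatic, and continuity then follows from [basis_bounded]. *)
Lemma is_adjoint_linear S T : is_adjoint S T -> linear T.
Proof.
move=> ST c u v; apply: dot_inj => w.
by rewrite dotC -ST dotDr dotZr !ST dotDl dotZl !(dotC _ w) rmorphD rmorphM /= !conjCK.
Qed.

End Commutants.

Section FiniteDimensional.
Context {R : realType} {H : hilbertSpace R} {I : finType} (e : I -> H).
Implicit Types (S T : H -> H) (u v : H).
Hypothesis eP : orthonormal_basis e.

Definition basis_trace T : \bar R := (rtrace e T)%:E.

Lemma von_neumann_bounded_op : von_neumann (@bounded_op R H).
Proof.
split; last exact: bounded_op_bicommutant.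
by move=> T S _ /is_adjoint_linear; exact: basis_bounded eP _.
Qed.

(** Faithfulness is the bound of a positive operator by its trace, normality is
    [directed_sup_trace], and semifiniteness is witnessed by [T] itself, all traces being finite. *)
Lemma nsf_trace_basis : nsf_trace bounded_op basis_trace.
Proof.
split.
- by move=> T [_ T0]; rewrite lee_fin rtrace_ge0.
- by move=> S T _ _; rewrite /basis_trace rtraceD EFinD.
- by move=> c T _ _; rewrite /basis_trace rtraceZ EFinM.
- move=> T S [Tl _] /is_adjoint_linear Sl.
  by rewrite /basis_trace /rtrace ctraceC.
- move=> T [[Tl _] T0] [trT]; apply/funext => v; apply/normr0_eq0/le_anti.
  have [c _ /(_ _ Tl T0)] := norm_le_rtrace eP v.
  by rewrite trT mulr0 normr_ge0 andbT.
- move=> D T Dpos Ddir Tsup; apply/le_anti/andP; split; last first.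
    apply: ge_ereal_sup => _ [S DS <-]; rewrite lee_fin rtrace_le //.
    by have [_ Tub _] := Tsup; exact: Tub.
  apply/lee_addgt0Pr => eps eps0.
  have [S DS TS] := directed_sup_trace eP Dpos Ddir Tsup eps0.
  rewrite -leeBlDr //; apply: le_trans (_ : basis_trace S <= _)%E; last first.
    by apply: ereal_sup_ubound; exists S.
  by rewrite /basis_trace -EFinB lee_fin; move: TS; rewrite rtraceB; lra.
- move=> T [bT T0] nT; exists T; split=> //; last exact: ltry.
  by move=> v; rewrite subrr dot0l.
Qed.

End FiniteDimensional.

Section GroupAverage.
Context {R : realType} {H : hilbertSpace R} {I : finType} (e : I -> H).
Local Notation C := R[i].
Hypothesis eP : orthonormal_basis e.
Context {V : finZmodType} (g : V -> H -> H) (G : pred V).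
Hypothesis g_bounded : forall r, bounded_op (g r).
Hypothesis g0 : g 0 = idfun.
Hypothesis gD : forall r s, g (r + s) = g r \o g s.
Hypothesis g_adj : forall r, is_adjoint (g r) (g (- r)).
Hypothesis G0 : G 0.
Hypothesis GD : forall r s, G r -> G s -> G (r + s).
Hypothesis GN : forall r, G r -> G (- r).
Implicit Types (S T : H -> H) (u v : H).

Definition group_commutant : set (H -> H) := commutant [set g r | r in [set r | G r]].

Definition group_average T : H -> H :=
  (#|G|%:R^-1 : C) *: \sum_(r | G r) (g r \o T \o g (- r)).

Lemma group_averageE T v :
  group_average T v = (#|G|%:R^-1 : C) *: \sum_(r | G r) g r (T (g (- r) v)).
Proof. by rewrite /group_average fctE fct_sumE. Qed.

Lemma gDE r s v : g (r + s) v = g r (g s v).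
Proof. by rewrite gD. Qed.

Lemma card_G_gt0 : (0 < #|G|)%N.
Proof. by apply/card_gt0P; exists 0; exact: G0. Qed.

Lemma group_commutantP T : group_commutant T <->
  bounded_op T /\ forall r v, G r -> T (g r v) = g r (T v).
Proof.
split=> -[bT TG]; split=> //.
  by move=> r v Gr; have /(congr1 (fun f => f v)) := TG (g r) (ex_intro2 _ _ r Gr erefl).
by move=> _ [r Gr <-]; apply/funext => v; exact: TG.
Qed.

(** The bicommutant condition is [tricommutant]; adjoints stay inside because [G] is closed under
    negation and [g (- r)] is the adjoint of [g r]. *)
Lemma von_neumann_group_commutant : von_neumann group_commutant.
Proof.
split; last by apply: tricommutant => _ [r _ <-]; exact: g_bounded.
move=> T S /group_commutantP[bT TG] TS; apply/group_commutantP; split.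
  by apply: (basis_bounded eP); exact: is_adjoint_linear TS.
move=> r v Gr; apply: dot_inj => w; rewrite dotC [RHS]dotC; congr (_^*).
have adjN x y : '[x, g r y] = '[g (- r) x, y] by rewrite g_adj opprK.
by rewrite -TS !adjN -TS TG // GN.
Qed.

Lemma group_average_range T : bounded_op T -> group_commutant (group_average T).
Proof.
move=> bT; have [Tl _] := bT.
apply/group_commutantP; split.
  apply: bounded_opZ; apply: bounded_op_sum => r.
  by apply: bounded_op_comp => //; exact: bounded_op_comp.
move=> s v Gs; rewrite !group_averageE (linear_opZ _ _ (g_bounded s).1).
rewrite (linear_op_sum _ _ _ (g_bounded s).1); congr (_ *: _).
rewrite (reindex_inj (addrI s)) /=; apply: eq_big => [r|r _].
  by apply/idP/idP => [Gsr|Gr]; [rewrite -(addKr s r); apply: GD => //; exact: GN | exact: GD].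
by rewrite /= -(gDE (- (s + r)) s v) opprD addrAC addNr add0r gDE.
Qed.

Lemma group_average_id T : group_commutant T -> group_average T = T.
Proof.
move=> /group_commutantP[bT TG]; apply/funext => v; rewrite group_averageE.
under eq_bigr => r Gr do rewrite -TG // -gDE subrr g0.
rewrite sumr_const -[X in _ *: X]scaler_nat scalerA mulVf ?scale1r //.
by rewrite pnatr_eq0 -lt0n card_G_gt0.
Qed.

Lemma group_average_linear (c : C) S T :
  group_average (c *: S + T) = c *: group_average S + group_average T.
Proof.
apply/funext => v; rewrite !fctE !group_averageE !scalerA mulrC -scalerA -scalerDr.
congr (_ *: _); rewrite scaler_sumr -big_split; apply: eq_bigr => r _.
exact: (g_bounded r).1.
Qed.

Lemma group_average_bimodule S T U : group_commutant S -> group_commutant U ->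
  group_average (S \o T \o U) = S \o group_average T \o U.
Proof.
move=> /group_commutantP[[Sl _] SG] /group_commutantP[_ UG]; apply/funext => v /=.
rewrite !group_averageE (linear_opZ _ _ Sl) (linear_op_sum _ _ _ Sl); congr (_ *: _).
by apply: eq_bigr => r Gr; rewrite /= SG // -UG // GN.
Qed.

Lemma group_average_dot T v : '[group_average T v, v] =
  #|G|%:R^-1 * \sum_(r | G r) '[T (g (- r) v), g (- r) v].
Proof.
rewrite group_averageE dotZl dot_suml; congr (_ * _); apply: eq_bigr => r _.
by rewrite g_adj.
Qed.

Lemma group_average_ge0 T : op_ge0 T -> op_ge0 (group_average T).
Proof.
move=> T0 v; rewrite group_average_dot mulr_ge0 ?invr_ge0 //.
by rewrite sumr_ge0 // => r _; exact: T0.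
Qed.

Lemma group_averageB S T : group_average (S - T) = group_average S - group_average T.
Proof.
by rewrite addrC -scaleN1r group_average_linear scaleN1r addrC.
Qed.

Lemma group_average_trace T : linear T -> ctrace e (group_average T) = ctrace e T.
Proof.
move=> Tl; rewrite /group_average ctraceZ.
have -> : ctrace e (\sum_(r | G r) (g r \o T \o g (- r))) = \sum_(r | G r) ctrace e T.
  rewrite (big_morph (ctrace e) (ctraceD e) (_ : ctrace e 0 = 0)); last first.
    by rewrite /ctrace big1 // => i _; rewrite dot0l.
  apply: eq_bigr => r _; have glin s := (g_bounded s).1.
  rewrite ctraceC //; last by move=> c u v /=; rewrite Tl glin.
  congr ctrace; apply/funext => v /=.
  by rewrite -gDE addNr g0.
rewrite sumr_const -[X in _ * X]mulr_natl mulrA mulVf ?mul1r //.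
by rewrite pnatr_eq0 -lt0n card_G_gt0.
Qed.

(** For the least upper bound, choose [S] in [D] with small tr(T - S). Replacing [T] by [S] changes
    the form of the average at [v] by at most a multiple of this trace, and [U] dominates the
    average of [S]. *)
Lemma group_average_normal D T : D `<=` pos_part bounded_op -> op_directed D ->
  op_sup bounded_op D T -> op_sup group_commutant (group_average @` D) (group_average T).
Proof.
move=> Dpos Ddir Tsup; have [[bT T0] Tub _] := Tsup; split.
- by split; [exact: group_average_range | exact: group_average_ge0].
- move=> _ [S DS <-]; rewrite /op_le -group_averageB; apply: group_average_ge0.
  exact: Tub.
move=> U _ Uub v.
have /choice [c cP] : forall r, exists c : R, 0 <= c /\ forall S, linear S -> op_ge0 S ->
    '[S (g (- r) v), g (- r) v] <= (c * rtrace e S)%:C.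
  move=> r; have [b b0 le_b] := dot_le_norm eP (g (- r) v).
  have [a a0 le_a] := norm_le_rtrace eP (g (- r) v).
  exists (a * b); split; first exact: mulr_ge0.
  move=> S Sl S0; rewrite -[leLHS]ger0_norm ?S0 // (le_trans (le_b _)) //.
  rewrite mulrAC rmorphM /= ler_wpM2r ?ler0c //; exact: le_a.
pose k := \sum_(r | G r) c r.
have k0 : 0 <= k by apply: sumr_ge0 => r _; have [] := cP r.
apply: complex_ge0_approx => eps eps0.
have k1 : 0 < k + 1 by rewrite ltr_wpDl.
have [S DS TS] := directed_sup_trace eP Dpos Ddir Tsup (divr_gt0 eps0 k1).
exists '[(U - group_average S) v, v]; first by apply: Uub; exists S.
rewrite -dotBl.
have -> : (U - group_average T) v - (U - group_average S) v = - group_average (T - S) v.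
  by rewrite group_averageB !fctE !opprB [LHS]addrC addrA subrK.
have [bTS _] : linear (T - S) /\ True by split => //; have [] := bounded_opB bT (Dpos _ DS).1.
rewrite -scaleN1r dotZl mulN1r normrN group_average_dot.
have TS0 : op_ge0 (T - S) by exact: Tub.
rewrite ger0_norm ?mulr_ge0 ?invr_ge0 ?sumr_ge0 //.
have : \sum_(r | G r) '[(T - S) (g (- r) v), g (- r) v] <= (k * rtrace e (T - S))%:C.
  rewrite mulr_suml rmorph_sum; apply: ler_sum => r _.
  by have [_] := cP r; exact.
move=> le_k.
apply: le_trans (_ : (k * rtrace e (T - S))%:C <= _).
  apply: le_trans le_k; rewrite ler_piMl ?sumr_ge0 // invf_le1 ?ler1n ?ltr0n ?card_G_gt0 //.
rewrite lecR; have tr0 := rtrace_ge0 e TS0.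
move: TS; rewrite ltr_pdivlMr // => TS; nra.
Qed.

(** Translating the summation index by [s] turns the sum into its own negative. *)
Lemma group_average_eq0 T s : G s ->
  (forall v, g s (T (g (- s) v)) = - T v) -> group_average T = 0.
Proof.
move=> Gs Ts; apply/funext => v; rewrite group_averageE.
set sum := \sum_(r | G r) _; suff -> : sum = 0 by rewrite scaler0.
have : sum = - sum.
  rewrite {1}/sum (reindex_inj (addIr s)) /= -sumrN; apply: eq_big => [r|r _].
    by apply/idP/idP => [Grs|Gr]; [rewrite -(addrK s r); apply: GD => //; exact: GN | exact: GD].
  rewrite gDE opprD addrC gDE Ts -scaleN1r (linear_opZ _ _ (g_bounded r).1).
  by rewrite scaleN1r.
move=> /eqP; rewrite -subr_eq0 opprK -mulr2n -scaler_nat scaler_eq0 pnatr_eq0 /=.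
by move=> /eqP.
Qed.

Lemma group_average_cexp :
  cond_expectation bounded_op group_commutant (basis_trace e) group_average.
Proof.
split.
- exact: group_average_range.
- by move=> c S T _ _; exact: group_average_linear.
- by move=> T [_ T0]; exact: group_average_ge0.
- exact: group_average_id.
- by move=> S T U GS _ GU; exact: group_average_bimodule.
- exact: group_average_normal.
- by move=> T [[Tl _] _]; rewrite /basis_trace /rtrace group_average_trace.
Qed.

End GroupAverage.

(** * Elements of von Neumann algebras with T^3 = c^2 T *)

Section VonNeumannAlgebra.
Context {R : realType} {H : hilbertSpace R}.
Local Notation C := R[i].
Implicit Types (M A : set (H -> H)) (S T : H -> H) (c : C).

Lemma commutantZD A c S T : A `<=` bounded_op ->
  commutant A S -> commutant A T -> commutant A (c *: S + T).
Proof.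
move=> bA [bS SA] [bT TA]; split=> [|U AU]; first exact: bounded_opZD.
apply/funext => v; rewrite /= !fctE.
have /(congr1 (fun f => f v)) /= -> := SA U AU.
have /(congr1 (fun f => f v)) /= -> := TA U AU.
by have [lU _] := bA _ AU; rewrite lU.
Qed.

Lemma commutant_comp A S T : commutant A S -> commutant A T -> commutant A (S \o T).
Proof.
move=> [bS SA] [bT TA]; split=> [|U AU]; first exact: bounded_op_comp.
by rewrite -compA TA // compA SA.
Qed.

Lemma commutant_id A : commutant A idfun.
Proof. by split=> //; exact: bounded_op_id. Qed.

Lemma commutant0 A : A `<=` bounded_op -> commutant A 0.
Proof.
move=> bA; split=> [|U /bA[lU _]]; first exact: bounded_op0.
by apply/funext => v /=; rewrite [RHS](linear_op0 lU).
Qed.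

Lemma vn_bounded M : von_neumann M -> M `<=` bounded_op.
Proof. by move=> [_ <-]; exact: commutant_bounded. Qed.

Lemma vnZD M c S T : von_neumann M -> M S -> M T -> M (c *: S + T).
Proof. by move=> [_ <-]; apply: commutantZD; exact: commutant_bounded. Qed.

Lemma vn_comp M S T : von_neumann M -> M S -> M T -> M (S \o T).
Proof. by move=> [_ <-]; exact: commutant_comp. Qed.

Lemma vn_id M : von_neumann M -> M idfun.
Proof. by move=> [_ <-]; exact: commutant_id. Qed.

Lemma vn0 M : von_neumann M -> M 0.
Proof. by move=> [_ <-]; apply: commutant0; exact: commutant_bounded. Qed.

Lemma vnD M S T : von_neumann M -> M S -> M T -> M (S + T).
Proof. by move=> vM MS MT; rewrite -[S]scale1r; exact: vnZD. Qed.

Lemma vnZ M c T : von_neumann M -> M T -> M (c *: T).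
Proof. by move=> vM MT; rewrite -[_ *: _]addr0; apply: vnZD => //; exact: vn0. Qed.

Lemma vn_sum M (K : Type) (r : seq K) (P : pred K) (F : K -> H -> H) :
  von_neumann M -> (forall k, P k -> M (F k)) -> M (\sum_(k <- r | P k) F k).
Proof.
move=> vM MF; elim/big_ind: _ => //; first exact: vn0.
by move=> S T; exact: vnD.
Qed.

Lemma nsf_trace0 M tau : von_neumann M -> nsf_trace M tau -> tau 0 = 0%E.
Proof.
move=> vM tauP; have pos0 : pos_part M 0.
  by split; [exact: vn0 | move=> v; rewrite dot0l].
by have := traceZ tauP (lexx 0) pos0; rewrite mul0e rmorph0 scale0r.
Qed.

End VonNeumannAlgebra.

Section CubicOperator.
Context {R : realType} {H : hilbertSpace R} (c : R) (T : H -> H).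
Local Notation C := R[i].
Hypothesis c_gt0 : 0 < c.
Hypothesis T_bounded : bounded_op T.
Hypothesis T_adj : is_adjoint T T.
Hypothesis T_cubic : forall v, T (T (T v)) = (c ^+ 2)%:C *: T v.

(** The polynomial a + b T^2 + d T, with the square before the linear term. As T^3 = c^2 T, such
    polynomials are closed under composition. *)
Definition quad (a b d : R) : H -> H :=
  a%:C *: idfun + (b%:C *: (T \o T) + d%:C *: T).

Lemma quadE a b d v : quad a b d v = a%:C *: v + (b%:C *: T (T v) + d%:C *: T v).
Proof. by []. Qed.

Lemma bounded_quad a b d : bounded_op (quad a b d).
Proof.
apply: bounded_opZD; first exact: bounded_op_id.
by apply: bounded_opZD; [exact: bounded_op_comp | exact: bounded_opZ].
Qed.

Lemma quadD a b d a' b' d' :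
  quad a b d + quad a' b' d' = quad (a + a') (b + b') (d + d').
Proof. by rewrite /quad !rmorphD !scalerDl addrACA; congr (_ + _); rewrite addrACA. Qed.

Lemma quadZ k a b d : k%:C *: quad a b d = quad (k * a) (k * b) (k * d).
Proof. by rewrite /quad !scalerDr !scalerA -!rmorphM. Qed.

Lemma quad_T a b d : T \o quad a b d = quad 0 d (a + b * c ^+ 2).
Proof.
apply/funext => v; have [Tl _] := T_bounded.
rewrite /= !quadE !(linear_opD _ _ Tl) !(linear_opZ _ _ Tl) T_cubic.
have bc : (b * c ^+ 2)%:C *: T v = b%:C *: ((c ^+ 2)%:C *: T v).
  by rewrite scalerA -rmorphM.
by rewrite scale0r add0r rmorphD scalerDl bc addrA [LHS]addrC.
Qed.

Lemma quad_comp a b d a' b' d' : quad a b d \o quad a' b' d' =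
  quad (a * a') (a * b' + b * (a' + b' * c ^+ 2) + d * d')
    (a * d' + b * (d' * c ^+ 2) + d * (a' + b' * c ^+ 2)).
Proof.
rewrite {1}/quad.
transitivity (a%:C *: quad a' b' d' +
  (b%:C *: (T \o (T \o quad a' b' d')) + d%:C *: (T \o quad a' b' d'))); first by [].
rewrite !quad_T !quadZ !quadD; congr quad; ring.
Qed.

Lemma quad_adjoint a b d : is_adjoint (quad a b d) (quad a b d).
Proof.
have adjZ k S : is_adjoint S S -> is_adjoint (k%:C *: S) (k%:C *: S).
  by move=> aS; rewrite -[X in is_adjoint _ (X *: _)]conj_realC; exact: is_adjointZ.
apply: is_adjointD; first exact: adjZ.
by apply: is_adjointD; apply: adjZ => //; exact: is_adjoint_comp.
Qed.

Lemma quad1 : quad 1 0 0 = idfun.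
Proof. by apply/funext => v; rewrite quadE !scale0r !addr0 scale1r. Qed.

Lemma quad0 : quad 0 0 0 = 0.
Proof. by apply/funext => v; rewrite quadE !scale0r !addr0. Qed.

Lemma quadT : quad 0 0 1 = T.
Proof. by apply/funext => v; rewrite quadE !scale0r !add0r scale1r. Qed.

Definition cubic_eigenvalue (k : option bool) : R :=
  if k is Some b then (-1) ^+ b * c else 0.

(* Spectral projections, by Lagrange interpolation at 0, c and -c. *)
Definition cubic_proj (k : option bool) : H -> H :=
  if k is Some b then quad 0 (2 * c ^+ 2)^-1 ((-1) ^+ b / (2 * c))
  else quad 1 (- (c ^+ 2)^-1) 0.

Lemma big_option_bool (W : nmodType) (f : option bool -> W) :
  \sum_k f k = f None + (f (Some true) + f (Some false)).
Proof.
rewrite (bigD1 None) //= (bigD1 (Some true)) //= (bigD1 (Some false)) //= big1 ?addr0 //.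
by case=> [[]|].
Qed.

Lemma resolution_cubic : resolution cubic_proj.
Proof.
have c0 : c != 0 by rewrite gt_eqF.
split.
- move=> k; split; case: k => [[]|] /=; try exact: bounded_quad;
    try exact: quad_adjoint; rewrite quad_comp; congr quad; rewrite ?expr0 ?expr1; by field.
- move=> j k jk v; rewrite -[LHS]/((cubic_proj j \o cubic_proj k) v).
  have -> : cubic_proj j \o cubic_proj k = 0; last by [].
  case: j k jk => [[]|] [[]|] //= _; rewrite quad_comp -quad0; congr quad;
    rewrite ?expr0 ?expr1; by field.
move=> v; rewrite big_option_bool /= -[RHS]/(idfun v) -quad1.
rewrite -[_ + _ v]/((quad _ _ _ + quad _ _ _) v).
rewrite -[LHS]/((quad _ _ _ + (quad _ _ _ + quad _ _ _)) v).
rewrite !quadD; congr (quad _ _ _ v); rewrite ?expr0 ?expr1; by field.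
Qed.

(** Interpolation of [phi] at 0, c and -c: the even part of [phi] feeds the square and the odd part
    feeds [T], which separates the term that a conditional expectation annihilates. *)
Lemma spec_op_cubic (phi : R -> R) :
  spec_op cubic_proj (phi \o cubic_eigenvalue) =
    quad (phi 0) ((phi c + phi (- c) - 2 * phi 0) / (2 * c ^+ 2))
      ((phi c - phi (- c)) / (2 * c)).
Proof.
have c0 : c != 0 by rewrite gt_eqF.
rewrite /spec_op big_option_bool /= !quadZ !quadD.
by congr quad; rewrite ?expr0 ?expr1 ?mul1r ?mulN1r; field.
Qed.

Lemma spec_op_cubic_id : spec_op cubic_proj cubic_eigenvalue = T.
Proof.
have c0 : c != 0 by rewrite gt_eqF.
transitivity (spec_op cubic_proj (id \o cubic_eigenvalue)); first by [].
by rewrite spec_op_cubic -[RHS]quadT; congr quad; field.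
Qed.

End CubicOperator.

Section SpectralTrace.
Context {R : realType} {H : hilbertSpace R} {I : finType} (e : I -> H).

Lemma rtrace_spec_op {K : finType} (P : K -> H -> H) (c : K -> R) :
  rtrace e (spec_op P c) = \sum_k c k * rtrace e (P k).
Proof.
rewrite /spec_op (big_morph (rtrace e) (rtraceD e) (rtrace0 e)).
by apply: eq_bigr => k _; rewrite rtraceZ.
Qed.

(** With finitely many eigenvalues the supremum is attained: truncation can only lower the trace,
    and a cut-off above all eigenvalues changes nothing. *)
Lemma trace_ext_basis {K : finType} (P : K -> H -> H) (c : K -> R) :
  resolution P -> (forall k, 0 <= c k) ->
  trace_ext bounded_op (basis_trace e) (op_graph (spec_op P c)) =
    (\sum_k c k * rtrace e (P k))%:E.
Proof.
move=> resP c0; rewrite trace_ext_spec // -rtrace_spec_op.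
have P0 k : 0 <= rtrace e (P k).
  apply: rtrace_ge0 => v; have [/(_ k) prP _ _] := resP.
  by rewrite (projection_dot _ prP) dot_ge0.
have trunc_le (n : nat) k : c k * \1_(`[0, n%:R]) (c k) <= c k.
  by rewrite ler_piMr // indicE; case: (_ \in _).
apply/le_anti/andP; split.
  apply: ge_ereal_sup => _ [T [_ [n ->]] <-]; rewrite lee_fin !rtrace_spec_op.
  by apply: ler_sum => k _; rewrite ler_wpM2r.
apply: ereal_sup_ubound; exists (spec_op P c) => //; split.
  by split; [exact: bounded_spec_op | exact: op_ge0_spec].
(* The eigenvalues are nonnegative, so their sum bounds each of them. *)
exists (Num.trunc (\sum_k c k)).+1; congr spec_op; apply/funext => k.
rewrite indicE mem_set ?mulr1 //= in_itv /= c0 /=.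
apply: le_trans (ltW (truncnS_gt _)); rewrite (bigD1 k) //= lerDl sumr_ge0 //.
Qed.

End SpectralTrace.

(** * Martingales of partial sums *)

Section MartingaleSums.
Context {R : realType} {F : filtered_vna R}.
Local Notation H := (fvn_space F).
Local Notation C := R[i].
Implicit Types (d : nat -> H -> H).

(** The sum stops before [n], so the martingale starts at 0 and [d n] is the increment from time [n]
    to [n.+1]. Both difference sequences are then 0 at time 0, where the convention on E_{-1}
    applies. *)
Definition psum d (n : nat) : H -> H := \sum_(i < n) d i.

Record difference_sequence d : Prop := DifferenceSequence {
  diff_filt : forall n, fvn_filt n.+1 (d n);
  diff_adj : forall n, is_adjoint (d n) (d n);
  diff_cexp : forall n, fvn_cexp n (d n) = 0 }.

Lemma fvn_filt_le m n : (m <= n)%N -> @fvn_filt R F m `<=` fvn_filt n.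
Proof.
elim: n => [|n IH]; first by rewrite leqn0 => /eqP ->.
rewrite leq_eqVlt => /orP[/eqP -> //|mn].
by apply: subset_trans (IH mn) _; exact: fvn_filt_mono.
Qed.

Lemma filt_bounded n : @fvn_filt R F n `<=` bounded_op.
Proof. by apply: vn_bounded; exact: fvn_filt_vn. Qed.

Lemma fvn_trace0 : @fvn_trace R F 0 = 0%E.
Proof. exact: nsf_trace0 (@fvn_alg_vn R F) (@fvn_trace_nsf R F). Qed.

Lemma filt_L1_0 n : L1_space (@fvn_filt R F n) (@fvn_trace R F) (op_graph 0).
Proof.
have vn := fvn_filt_vn F n.
by apply: L1_space0; [exact: vn_id | exact: vn0 | exact: fvn_trace0].
Qed.

Lemma psum_filt d n : difference_sequence d -> fvn_filt n (psum d n).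
Proof.
move=> dP; apply: vn_sum => [|i _]; first exact: fvn_filt_vn.
by apply: (fvn_filt_le (ltn_ord i)); exact: diff_filt.
Qed.

Lemma psumS d n : psum d n.+1 = psum d n + d n.
Proof. by rewrite /psum big_ord_recr. Qed.

Lemma filt_adapted (T : nat -> H -> H) :
  (forall n, fvn_filt n (T n)) -> adapted (fun n => op_graph (T n)).
Proof.
move=> filtT n; exists (op_graph 0), (T n); split; [exact: filt_L1_0 | by [] |].
rewrite strong_add_op_graph ?add0r //; first exact: bounded_op0.
exact: filt_bounded.
Qed.

Lemma self_adjoint_martingale_psum d : difference_sequence d ->
  self_adjoint_martingale (fun n => op_graph (psum d n)).
Proof.
move=> dP; have bX n : bounded_op (psum d n).
  by apply: filt_bounded; exact: psum_filt.
have vA := @fvn_alg_vn R F.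
split; last first.
  move=> n; apply: self_adjoint_op_graph => //.
  by apply: is_adjoint_sum => i; exact: diff_adj.
split; first by apply: filt_adapted => n; exact: psum_filt.
move=> n; have cE := fvn_cexpP F n.
have MX m : fvn_alg (psum d m) by apply: (fvn_filt_sub (n := m)); exact: psum_filt.
have Md : fvn_alg (d n) by apply: (fvn_filt_sub (n := n.+1)); exact: diff_filt.
have EX : fvn_cexp n (psum d n.+1) = psum d n.
  rewrite psumS -[psum d n]scale1r (cexp_linear cE) // (diff_cexp dP) addr0.
  by rewrite (cexp_id cE) //; exact: psum_filt.
have E0 : fvn_cexp n (0 : H -> H) = 0 by rewrite (cexp_id cE) //; apply: vn0; exact: fvn_filt_vn.
(* The whole operator is its bounded component; the L^1 components and their approximants are
   zero. *)
exists (op_graph 0), (op_graph 0), (psum d n.+1); split.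
  split; [|exact: filt_L1_0|exact: MX| |].
  - by apply: L1_space0; [exact: vn_id | exact: vn0 | exact: fvn_trace0].
  - by rewrite strong_add_op_graph ?add0r //; exact: bounded_op0.
  - by rewrite EX strong_add_op_graph ?add0r //; exact: bounded_op0.
have norm0 : Lp_norm (@fvn_alg R F) (@fvn_trace R F) 1
    (strong_sub (op_graph 0) (op_graph 0)) = 0%E.
  rewrite strong_sub_op_graph; try exact: bounded_op0.
  by rewrite subrr Lp_norm0 //; [exact: vn0 | exact: fvn_trace0].
exists (fun=> 0); split; first by move=> k; exact: vn0.
  by under eq_fun do rewrite norm0; exact: cvg_cst.
by under eq_fun do rewrite E0 norm0; exact: cvg_cst.
Qed.

Lemma mdiff_psum d : difference_sequence d ->
  mdiff (fun n => op_graph (psum d n)) =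
    (fun n => op_graph (if n is m.+1 then d m else 0)).
Proof.
move=> dP; have bX n : bounded_op (psum d n).
  by apply: filt_bounded; exact: psum_filt.
apply/funext => -[|m] /=; first by rewrite /psum big_ord0.
by rewrite strong_sub_op_graph // psumS addrC addKr.
Qed.

Definition partial_isometries d : Prop := forall n v, d n (d n (d n v)) = d n v.

(** In the expectation of [phi] of a difference, the linear term vanishes by the martingale
    property; what remains depends on the square only, which both sequences share. *)
Lemma tangent_psum d d' : difference_sequence d -> difference_sequence d' ->
  partial_isometries d -> partial_isometries d' ->
  (forall n, d n \o d n = d' n \o d' n) ->
  tangent (mdiff (fun n => op_graph (psum d n))) (mdiff (fun n => op_graph (psum d' n))).
Proof.
move=> dP d'P d3 d'3 dd'; rewrite !mdiff_psum //.
(* Differences indexed by time, so that the expectation at [n.-1] kills [D d n] for every [n],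
   including 0. *)
pose D (d : nat -> H -> H) n : H -> H := if n is m.+1 then d m else 0.
rewrite -[X in tangent X _]/(fun n => op_graph (D d n)).
rewrite -[X in tangent _ X]/(fun n => op_graph (D d' n)).
have D_filt d0 n : difference_sequence d0 -> fvn_filt n (D d0 n).
  by case: n => [_|n d0P]; [apply: vn0; exact: fvn_filt_vn | exact: (diff_filt d0P n)].
have D_cexp d0 n : difference_sequence d0 -> fvn_cexp n.-1 (D d0 n) = 0.
  case: n => [_|n d0P]; last by rewrite /= (diff_cexp d0P).
  rewrite (cexp_id (fvn_cexpP F 0%N)) //.
  by apply: vn0; exact: fvn_filt_vn.
have D_adj d0 n : difference_sequence d0 -> is_adjoint (D d0 n) (D d0 n).
  case: n => [_ u v|n d0P]; last exact: (diff_adj d0P n).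
  exact: etrans (dot0l v) (esym (dot0r u)).
have D_cubic d0 n : partial_isometries d0 ->
    forall v, D d0 n (D d0 n (D d0 n v)) = ((1 : R) ^+ 2)%:C *: D d0 n v.
  by move=> d03 v; rewrite expr1n scale1r; case: n => [|n] //; exact: d03.
have D_sqr n : D d n \o D d n = D d' n \o D d' n by case: n => [|n] //; exact: dd'.
split; [by apply: filt_adapted => n; exact: D_filt..|].
move=> n phi mphi _.
have vA := @fvn_alg_vn R F; have cE := fvn_cexpP F n.-1.
pose a := phi 0; pose b := (phi 1 + phi (- 1) - 2 * phi 0) / (2 * 1 ^+ 2).
pose k := (phi 1 - phi (- 1)) / (2 * 1).
have calc d0 : difference_sequence d0 -> partial_isometries d0 ->
    op_graph (quad (D d0 n) a b k) = borel_calc phi (op_graph (D d0 n)).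
  move=> d0P d03; have bD := filt_bounded (D_filt d0 n d0P).
  have cub := D_cubic d0 n d03.
  rewrite -[X in borel_calc _ (op_graph X)](spec_op_cubic_id (D d0 n) ltr01).
  by rewrite (borel_calc_spec (resolution_cubic ltr01 bD (D_adj d0 n d0P) cub)) // spec_op_cubic.
have MD d0 : difference_sequence d0 -> fvn_alg (D d0 n).
  by move=> /(D_filt _ n); exact: fvn_filt_sub.
have Mquad d0 : difference_sequence d0 -> fvn_alg (quad (D d0 n) a b k).
  move=> /MD MDn; apply: vnZD => //; first exact: vn_id.
  by apply: vnZD => //; [exact: vn_comp | exact: vnZ].
have Equad d0 : difference_sequence d0 -> fvn_cexp n.-1 (quad (D d0 n) a b k) =
    a%:C *: fvn_cexp n.-1 idfun + b%:C *: fvn_cexp n.-1 (D d0 n \o D d0 n).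
  move=> d0P; have MDn := MD d0 d0P.
  rewrite (cexp_linear cE); [|exact: vn_id|]; last first.
    by apply: (vnZD _ vA); [exact: vn_comp | exact: vnZ].
  rewrite (cexp_linear cE); [|exact: vn_comp|exact: vnZ].
  rewrite -[k%:C *: _]addr0 (cexp_linear cE) //; last exact: vn0.
  have E0 : fvn_cexp n.-1 (0 : H -> H) = 0.
    by rewrite (cexp_id cE) //; apply: vn0; exact: fvn_filt_vn.
  by rewrite D_cexp // scaler0 E0 !addr0.
exists (quad (D d n) a b k), (quad (D d' n) a b k); split.
- by split; exact: Mquad.
- exact: calc.
- exact: calc.
- by rewrite !Equad // D_sqr.
Qed.

End MartingaleSums.

(** * The counterexample *)

Section CoordinateProjections.
Context {R : realType} {H : hilbertSpace R} {I : finType} (e : I -> H).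
Hypothesis eP : orthonormal_basis e.

Definition coord_proj (i : I) (v : H) : H := '[v, e i] *: e i.

Lemma linear_coord_proj i : linear (coord_proj i).
Proof. by move=> c u v; rewrite /coord_proj dotDl dotZl scalerDl scalerA. Qed.

Lemma resolution_coord_proj : resolution coord_proj.
Proof.
split=> [i|i j ij v|v]; last exact: esym (eP.2 v).
  split; first by apply: (basis_bounded eP); exact: linear_coord_proj.
    apply/funext => v; rewrite /= /coord_proj dotZl (eP.1 i i) eqxx mulr1 //.
  by move=> u v; rewrite /coord_proj dotZl dotZr -dotC mulrC.
by rewrite /coord_proj dotZl eP.1 eq_sym (negbTE ij) mulr0 scale0r.
Qed.

Lemma rtrace_coord_proj i : rtrace e (coord_proj i) = 1.
Proof.
rewrite /rtrace /ctrace (bigD1 i) //= big1 => [|j ji].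
  by rewrite /coord_proj dotZl eP.1 eqxx mulr1 addr0.
by rewrite /coord_proj dotZl eP.1 (negbTE ji) mul0r.
Qed.

End CoordinateProjections.

Section Monomial.
Context {R : realType} {I : finType}.
Local Notation H := (l2_hilbert (R := R) (I := I)).
Local Notation C := R[i].
Implicit Types (u v : H) (s : I -> I) (w : I -> C).

Definition coord v (i : I) : C := (v : l2 R I) i.

Lemma coordP u v : (forall i, coord u i = coord v i) -> u = v.
Proof. by move=> uv; apply/ffunP. Qed.

Lemma coordD u v i : coord (u + v) i = coord u i + coord v i.
Proof. by rewrite /coord ffunE. Qed.

Lemma coordZ c v i : coord (c *: v) i = c * coord v i.
Proof. by rewrite /coord ffunE. Qed.

Lemma coord0 i : coord 0 i = 0.
Proof. by rewrite /coord ffunE. Qed.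

Lemma coord_sum (K : Type) (r : seq K) (P : pred K) (F : K -> H) i :
  coord (\sum_(k <- r | P k) F k) i = \sum_(k <- r | P k) coord (F k) i.
Proof.
by apply: (big_morph (fun u => coord u i)) => [u v|]; [exact: coordD|exact: coord0].
Qed.

Lemma l2_dotE u v : '[u, v] = \sum_i coord u i * (coord v i)^*.
Proof. by []. Qed.

Definition std_basis (i : I) : H := ([ffun j => (j == i)%:R] : l2 R I).

Lemma coord_std_basis i j : coord (std_basis i) j = (j == i)%:R.
Proof. by rewrite /coord ffunE. Qed.

Lemma dot_std_basis v i : '[v, std_basis i] = coord v i.
Proof.
rewrite l2_dotE (bigD1 i) //= big1 => [|j ji]; rewrite coord_std_basis.
  by rewrite eqxx conjC1 mulr1 addr0.
by rewrite (negbTE ji) conjC0 mulr0.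
Qed.

Lemma std_basisP : orthonormal_basis std_basis.
Proof.
split=> [i j|v]; first by rewrite dot_std_basis coord_std_basis eq_sym.
apply: coordP => i; rewrite coord_sum (bigD1 i) //= big1 => [|j ji].
  by rewrite coordZ dot_std_basis coord_std_basis eqxx mulr1 addr0.
by rewrite coordZ coord_std_basis eq_sym (negbTE ji) mulr0.
Qed.

(** A weighted permutation matrix when [s] is a bijection. Flips, arrows and coins all have this
    form, which reduces their relations to identities between indices and weights. *)
Definition monomial s w v : H := ([ffun i => w i * coord v (s i)] : l2 R I).

Lemma monomialE s w v i : coord (monomial s w v) i = w i * coord v (s i).
Proof. by rewrite /coord ffunE. Qed.

Lemma monomial_bounded s w : bounded_op (monomial s w).
Proof.
apply: (basis_bounded std_basisP) => c u v; apply: coordP => i.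
by rewrite coordD coordZ !monomialE coordD coordZ mulrDr mulrCA.
Qed.

Lemma monomial_adjoint s w : involutive s -> (forall i, (w (s i))^* = w i) ->
  is_adjoint (monomial s w) (monomial s w).
Proof.
move=> sK ws u v; rewrite !l2_dotE (reindex_inj (inv_inj sK)) /=.
apply: eq_bigr => i _; rewrite !monomialE sK rmorphM /= -(ws (s i)) sK.
by rewrite mulrA [X in X * _]mulrC.
Qed.

End Monomial.

Section Example.
Context {R : realType} (N : nat).
Local Notation C := R[i].
Local Notation V := 'rV[bool]_N.
Local Notation I := (option 'I_N * V)%type.
Local Notation H := (l2_hilbert (R := R) (I := I)).
Implicit Types (r s : V) (k : 'I_N) (j : option 'I_N) (v : H).

Lemma rV_boolD r s k : (r + s) 0 k = r 0 k (+) s 0 k.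
Proof. by rewrite mxE. Qed.

Lemma rV_bool_addrr r : r + r = 0.
Proof. by apply/rowP => k; rewrite !mxE; case: (r 0 k). Qed.

Lemma rV_bool_oppr r : - r = r.
Proof. by apply/eqP; rewrite eq_sym -addr_eq0 rV_bool_addrr. Qed.

(* [None] is the index of e_0 and [Some k] that of e_(k+1); [flip], [arrow] and
   [coin] are the g, a and b of the introduction. *)
Definition sgn_at r j : bool := if j is Some k then r 0 k else false.

Definition flip r : H -> H :=
  monomial (fun i : I => (i.1, i.2 + r)) (fun i => (-1) ^+ sgn_at r i.1).

Definition touches k j : bool := if j is Some l then l == k else true.

Definition swap k j : option 'I_N :=
  if j is Some l then (if l == k then None else j) else Some k.

Definition arrow k : H -> H :=
  monomial (fun i : I => (swap k i.1, i.2)) (fun i => (touches k i.1)%:R).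

Definition coin k : H -> H :=
  monomial (fun i : I => i) (fun i => (-1) ^+ (i.2 0 k) * (touches k i.1)%:R).

Lemma swapK k : involutive (swap k).
Proof.
case=> [l|] /=; last by rewrite eqxx.
by have [->|/negbTE lk] //= := eqVneq l k; rewrite lk.
Qed.

Lemma touches_swap k j : touches k (swap k j) = touches k j.
Proof.
case: j => [l|] /=; last by rewrite eqxx.
by have [//|/negbTE lk] /= := eqVneq l k.
Qed.

(** The arrow exchanges e_0, which never carries a sign, with the one basis vector that carries the
    sign of bit [k]. *)
Lemma sgn_at_swap r k j : touches k j -> sgn_at r j (+) sgn_at r (swap k j) = r 0 k.
Proof. by case: j => [l|] //= /eqP ->; rewrite eqxx addbF. Qed.

Lemma conj_sign (b : bool) : ((-1) ^+ b : C)^* = (-1) ^+ b.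
Proof. by rewrite rmorph_sign. Qed.

Lemma flip0 : flip 0 = idfun.
Proof.
apply/funext => v; apply: coordP => -[j s]; rewrite monomialE /= addr0.
by case: j => [k|] /=; rewrite ?mxE mul1r.
Qed.

Lemma flipD r s : flip (r + s) = flip r \o flip s.
Proof.
apply/funext => v; apply: coordP => -[j t]; rewrite /= !monomialE /= mulrA -signr_addb.
rewrite addrA; congr ((-1) ^+ _ * _).
by case: j => [k|] //=; rewrite rV_boolD.
Qed.

Lemma flip_adj r : is_adjoint (flip r) (flip (- r)).
Proof.
rewrite rV_bool_oppr; apply: monomial_adjoint => [[j s]|[j s]] /=.
  by rewrite -addrA rV_bool_addrr addr0.
exact: conj_sign.
Qed.

(** The shifts of the coins cancel, and the sign is the mismatch between the two ends of the
    arrow. *)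
Lemma flip_arrow r k v : flip r (arrow k (flip (- r) v)) = (-1) ^+ (r 0 k) *: arrow k v.
Proof.
apply: coordP => -[j s]; rewrite coordZ !monomialE /= rV_bool_oppr -addrA rV_bool_addrr addr0.
have [tj|ntj] := boolP (touches k j); last by rewrite !(mul0r, mulr0).
by rewrite !mul1r mulrA -signr_addb sgn_at_swap.
Qed.

(** The opposite mechanism: the signs on the basis vectors cancel in pairs, and the shift of the
    coins produces the factor. *)
Lemma flip_coin r k v : flip r (coin k (flip (- r) v)) = (-1) ^+ (r 0 k) *: coin k v.
Proof.
apply: coordP => -[j s]; rewrite coordZ !monomialE /= rV_bool_oppr -addrA rV_bool_addrr addr0.
rewrite rV_boolD signr_addb.
have := signrMK (sgn_at r j) (coord v (j, s)).
move: ((-1) ^+ sgn_at r j) => x xx.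
by rewrite -{2}xx; ring.
Qed.

Lemma arrow_adj k : is_adjoint (arrow k) (arrow k).
Proof.
apply: monomial_adjoint => [[j s]|[j s]] /=; first by rewrite swapK.
by rewrite touches_swap conjC_nat.
Qed.

Lemma coin_adj k : is_adjoint (coin k) (coin k).
Proof.
apply: monomial_adjoint => // -[j s] /=.
by rewrite rmorphM /= conj_sign conjC_nat.
Qed.

Lemma arrow_sqr k v i : coord (arrow k (arrow k v)) i = (touches k i.1)%:R * coord v i.
Proof.
case: i => j s; rewrite !monomialE /= touches_swap swapK mulrA -natrM mulnb andbb //.
Qed.

Lemma coin_sqr k v i : coord (coin k (coin k v)) i = (touches k i.1)%:R * coord v i.
Proof.
case: i => j s; rewrite !monomialE /=.
by case: (touches k j); rewrite /= ?mulr1 ?mulr0 ?mul0r ?mul1r // signrMK.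
Qed.

Lemma arrow_coin_sqr k : arrow k \o arrow k = coin k \o coin k.
Proof.
by apply/funext => v; apply: coordP => i /=; rewrite arrow_sqr coin_sqr.
Qed.

Lemma arrow_cubic k v : arrow k (arrow k (arrow k v)) = arrow k v.
Proof.
apply: coordP => i; rewrite arrow_sqr !monomialE mulrA -natrM mulnb andbb //.
Qed.

Lemma coin_cubic k v : coin k (coin k (coin k v)) = coin k v.
Proof.
apply: coordP => i; rewrite coin_sqr !monomialE mulrA; congr (_ * _).
by case: (touches _ _); rewrite !(mulr0, mulr1, mul0r, mul1r).
Qed.

(** The group generated by the g_j with j > n: coordinate [k] of ['I_N], counted from 0, stands for
    j = k + 1. *)
Definition late (n : nat) : pred V :=
  fun r => [forall k : 'I_N, (k < n)%N ==> ~~ r 0 k].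

Lemma lateP n r : reflect (forall k : 'I_N, (k < n)%N -> r 0 k = false) (late n r).
Proof.
apply: (iffP forallP) => /= rn k; first by move=> kn; have /implyP/(_ kn)/negbTE := rn k.
by apply/implyP => /rn ->.
Qed.

Lemma late0 n : late n 0.
Proof. by apply/lateP => k _; rewrite mxE. Qed.

Lemma lateD n r s : late n r -> late n s -> late n (r + s).
Proof. by move=> /lateP rn /lateP sn; apply/lateP => k kn; rewrite mxE rn // sn. Qed.

Lemma lateN n r : late n r -> late n (- r).
Proof. by rewrite rV_bool_oppr. Qed.

Definition ex_filt (n : nat) : set (H -> H) := group_commutant flip (late n).
Definition ex_cexp (n : nat) : (H -> H) -> H -> H := group_average flip (late n).
Definition ex_trace : (H -> H) -> \bar R := basis_trace (@std_basis R I).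

Lemma flip_bounded r : bounded_op (flip r).
Proof. exact: monomial_bounded. Qed.

Lemma ex_filt_vn n : von_neumann (ex_filt n).
Proof.
apply: (von_neumann_group_commutant std_basisP flip_bounded flip_adj).
exact: lateN.
Qed.

Lemma ex_filt_sub n : ex_filt n `<=` bounded_op.
Proof. exact: commutant_bounded. Qed.

Lemma ex_filt_mono n : ex_filt n `<=` ex_filt n.+1.
Proof.
apply: commutantS => _ [r /= rn <-]; exists r => //=.
by apply/lateP => k kn; have /lateP := rn; apply; exact: ltnW.
Qed.

(** At time [N] the group of late flips is trivial. Weak* density of the union follows at once. *)
Lemma ex_filt_top : ex_filt N = bounded_op.
Proof.
apply/seteqP; split; first exact: ex_filt_sub.
move=> T bT; apply/group_commutantP; split=> // r v /lateP rN.
have -> : r = 0 by apply/rowP => k; rewrite rN // mxE.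
by rewrite flip0.
Qed.

Lemma ex_filt_dense : weak_star_dense (\bigcup_n ex_filt n) (@bounded_op R H).
Proof.
move=> m a b T eps _ bT eps0; exists T; first by exists N => //; rewrite ex_filt_top.
move=> j; rewrite /normal_functional subrr.
under eq_fun do rewrite dot0l.
rewrite (_ : series _ = cst 0); last by apply/funext => n; rewrite /series /= big1.
by rewrite lim_cst // normr0 ltcR.
Qed.

Lemma ex_cexpP n : cond_expectation bounded_op (ex_filt n) ex_trace (ex_cexp n).
Proof.
apply: (group_average_cexp std_basisP flip_bounded flip0 flipD flip_adj).
- exact: late0.
- exact: lateD.
- exact: lateN.
Qed.

Definition ex_vna : filtered_vna R :=
  @FilteredVna R H bounded_op ex_trace ex_filt ex_cexp
    (von_neumann_bounded_op std_basisP) (nsf_trace_basis std_basisP)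
    ex_filt_vn ex_filt_sub ex_filt_mono ex_filt_dense ex_cexpP.

Definition stopped (d : 'I_N -> H -> H) (n : nat) : H -> H :=
  if insub n is Some k then d k else 0.

Lemma difference_sequence_stopped (d : 'I_N -> H -> H) :
  (forall k, bounded_op (d k)) -> (forall k, is_adjoint (d k) (d k)) ->
  (forall r k v, flip r (d k (flip (- r) v)) = (-1) ^+ (r 0 k) *: d k v) ->
  @difference_sequence R ex_vna (stopped d).
Proof.
move=> bd ad fd; split=> n; rewrite /stopped; case: insubP => [k _ kn|_] /=.
(* Elements of [late n.+1] have bit [k = n] equal to 0, so the sign relation becomes commutation. *)
- apply/group_commutantP; split=> // r v /lateP/(_ k); rewrite kn => /(_ (ltnSn n)) rk.
  have := fd r k (flip r v); rewrite rk scale1r => <-.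
  by rewrite -[flip (- r) _]/((flip (- r) \o flip r) v) -flipD addNr flip0.
- exact: vn0 (ex_filt_vn _).
- exact: ad.
- by move=> u v; exact: etrans (dot0l v) (esym (dot0r u)).
(* The single-bit element at [k = n] belongs to [late n] and reverses the sign of [d k]. *)
- pose s : V := \row_l (l == k).
  apply: (group_average_eq0 flip_bounded flipD (@lateD n) (@lateN n) (s := s)).
    by apply/lateP => l ln; rewrite mxE; apply/negbTE; rewrite neq_ltn -kn in ln *; rewrite ln.
  by move=> v; rewrite fd mxE eqxx scaleN1r.
- by rewrite [LHS](cexp_id (ex_cexpP n)) //; exact: vn0 (ex_filt_vn _).
Qed.

End Example.

(** * Norms and spectral projections of the two sums *)

Section ExampleSums.
Context {R : realType} (N : nat).
Local Notation C := R[i].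
Local Notation V := 'rV[bool]_N.
Local Notation I := (option 'I_N * V)%type.
Local Notation H := (l2_hilbert (R := R) (I := I)).
Local Notation F := (ex_vna (R := R) N).
Local Notation e := (@std_basis R I).
Implicit Types (s : V) (k : 'I_N) (v : H) (p : R).

Definition ex_mart (d : 'I_N -> H -> H) (n : nat) : set (H * H) :=
  op_graph (@psum R F (stopped d) n).

Lemma psum_stopped (d : 'I_N -> H -> H) :
  @psum R F (stopped d) N = \sum_k d k.
Proof. by apply: eq_bigr => k _; rewrite /stopped valK. Qed.

Lemma coord_sum_arrow v (i : I) : coord ((\sum_k arrow k) v) i =
  if i.1 is Some k then coord v (None, i.2) else \sum_k coord v (Some k, i.2).
Proof.
rewrite fct_sumE coord_sum; case: i => [[l|] s] /=; last first.
  by apply: eq_bigr => k _; rewrite monomialE mul1r.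
rewrite (bigD1 l) //= big1 => [|k kl]; rewrite monomialE /=.
  by rewrite eqxx mul1r addr0.
by rewrite eq_sym (negbTE kl) mul0r.
Qed.

Lemma sum_arrow_bounded : bounded_op (\sum_k @arrow R N k).
Proof. by apply: bounded_op_sum => k; exact: monomial_bounded. Qed.

Lemma sum_arrow_adj : is_adjoint (\sum_k @arrow R N k) (\sum_k @arrow R N k).
Proof. by apply: is_adjoint_sum => k; exact: arrow_adj. Qed.

(** For each coin pattern, the sum of the arrows is the adjacency matrix of a star with centre
    [None] and [N] leaves; a third step retraces the first in [N] ways. *)
Lemma sum_arrow_cubic v : let X := \sum_k @arrow R N k in
  X (X (X v)) = (N%:R : C) *: X v.
Proof.
move=> X; apply: coordP => -[[l|] s]; rewrite coordZ.
  rewrite !coord_sum_arrow /=.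
  under eq_bigr do rewrite coord_sum_arrow /=.
  by rewrite sumr_const card_ord -[LHS]mulr_natl.
rewrite coord_sum_arrow /= [in RHS]coord_sum_arrow /=.
under eq_bigr do rewrite !coord_sum_arrow /=.
by rewrite sumr_const card_ord -[LHS]mulr_natl.
Qed.

(** The diagonal of the square lists the degrees in the star: [N] at the centre and 1 at each
    leaf. *)
Lemma rtrace_sum_arrow_sqr : let X := \sum_k @arrow R N k in
  rtrace e (X \o X) = 2 * N%:R * #|V|%:R.
Proof.
move=> X.
have diag (i : I) : '[(X \o X) (e i), e i] = if i.1 is Some _ then 1 else N%:R.
  rewrite dot_std_basis /= coord_sum_arrow; case: i => [[l|] s] /=.
    rewrite coord_sum_arrow /= (bigD1 l) //= big1 => [|k kl]; rewrite coord_std_basis.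
      by rewrite eqxx addr0.
    by rewrite xpair_eqE /= -[Some k == Some l]/(k == l) (negbTE kl).
  under eq_bigr do rewrite coord_sum_arrow /= coord_std_basis eqxx.
  by rewrite sumr_const card_ord.
have -> : rtrace e (X \o X) = complex.Re ((2 * N%:R * #|V|%:R : R)%:C).
  congr complex.Re; rewrite /ctrace (eq_bigr _ (fun i _ => diag i)).
  rewrite -(pair_bigA _ (fun (j : option 'I_N) (s : V) => if j is Some _ then 1 else N%:R)) /=.
  rewrite (eq_bigr (fun j : option 'I_N => (if j is Some _ then 1 else N%:R) * #|V|%:R)).
    rewrite -mulr_suml (bigD1 None) //= (reindex_omap Some id) /=; last by case.
    rewrite (eq_bigl xpredT) => [|k]; last by rewrite eqxx.
    rewrite sumr_const card_ord.
    by rewrite !rmorphM !rmorph_nat; ring.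
  by move=> j _; rewrite sumr_const -[LHS]mulr_natr; case: j.
by [].
Qed.

(** The joint eigenvalue of the commuting coins: a full sum of [N] signs on e_0, a single sign on
    every other e_k. *)
Definition coin_value (i : I) : R :=
  \sum_k (-1) ^+ (i.2 0 k) * (touches k i.1)%:R.

Lemma sum_coin : \sum_k @coin R N k = spec_op (coord_proj e) coin_value.
Proof.
apply/funext => v; apply: coordP => i; rewrite fct_sumE coord_sum spec_opE coord_sum.
rewrite [RHS](bigD1 i) //= [X in _ = _ + X]big1 => [|j ji]; last first.
  by rewrite /coord_proj !coordZ coord_std_basis eq_sym (negbTE ji) !mulr0.
rewrite /coord_proj !coordZ coord_std_basis eqxx mulr1 dot_std_basis addr0 /coin_value.
rewrite rmorph_sum mulr_suml; apply: eq_bigr => k _; rewrite monomialE.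
by rewrite rmorphM /= rmorph_sign rmorph_nat.
Qed.

Lemma coin_value_Some k s : `|coin_value (Some k, s)| = 1.
Proof.
rewrite /coin_value (bigD1 k) //= big1 => [|l lk].
  by rewrite eqxx mulr1 addr0 normr_sign.
by rewrite eq_sym (negbTE lk) mulr0.
Qed.

(** Only the indices [Some k] are counted. A general [f] serves both t^p and the indicator of [1,
    oo). *)
Lemma sum_coin_value_ge (f : R -> R) : (forall t, 0 <= f t) -> f 1 = 1 ->
  N%:R * #|V|%:R <= \sum_i f `|coin_value i|.
Proof.
move=> f0 f1; pose h (j : option 'I_N) (s : V) := f `|coin_value (j, s)|.
rewrite (eq_bigr (fun i : I => h i.1 i.2)) => [|[]//].
rewrite -(pair_bigA _ h) /= (bigD1 None) //= ler_wpDl ?sumr_ge0 // => [s _|]; first exact: f0.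
rewrite (reindex_omap Some id) /=; last by case.
rewrite (eq_bigl xpredT) => [|k]; last by rewrite eqxx.
rewrite (eq_bigr (fun=> #|V|%:R)) => [|k _].
  by rewrite sumr_const card_ord -[leRHS]mulr_natl.
by rewrite (eq_bigr (fun=> 1)) ?sumr_const // => s _; rewrite /h coin_value_Some f1.
Qed.

Lemma ex_mart_hyps : [/\ @self_adjoint_martingale R F (ex_mart (@arrow R N)),
  @self_adjoint_martingale R F (ex_mart (@coin R N)) &
  @tangent R F (@mdiff R F (ex_mart (@arrow R N))) (@mdiff R F (ex_mart (@coin R N)))].
Proof.
have dA : @difference_sequence R F (stopped (@arrow R N)).
  apply: difference_sequence_stopped; [|exact: arrow_adj|exact: flip_arrow].
  by move=> k; exact: monomial_bounded.
have dB : @difference_sequence R F (stopped (@coin R N)).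
  apply: difference_sequence_stopped; [|exact: coin_adj|exact: flip_coin].
  by move=> k; exact: monomial_bounded.
split; [exact: self_adjoint_martingale_psum..|].
apply: tangent_psum => // [n v|n v|n]; rewrite /stopped; case: insub => [k|] //.
- exact: arrow_cubic.
- exact: coin_cubic.
- exact: arrow_coin_sqr.
Qed.

(** Interpolating |t|^p at 0, c and -c gives |X|^p = c^(p-2) X^2, so the trace of the square is
    enough and no eigenvector of [X] is computed. *)
Lemma norm_arrow (c p : R) : 0 < c -> c ^+ 2 = N%:R -> 0 < p ->
  @norm_Lp R F p (ex_mart (@arrow R N) N) =
    ((2 * c `^ p * #|V|%:R) `^ p^-1)%:E.
Proof.
move=> c0 cN p0; rewrite /norm_Lp /ex_mart psum_stopped.
set X := \sum_k _.
have cub v : X (X (X v)) = (c ^+ 2)%:C *: X v.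
  by rewrite cN rmorph_nat; exact: sum_arrow_cubic.
have resX := resolution_cubic c0 sum_arrow_bounded sum_arrow_adj cub.
rewrite -(spec_op_cubic_id X c0) /Lp_norm (modulus_powR_spec resX).
rewrite [trace_ext _ _ _](trace_ext_basis e resX); last first.
  by move=> k; exact: powR_ge0.
rewrite -rtrace_spec_op poweR_EFin; congr ((_ `^ _)%:E).
rewrite (spec_op_cubic X c0 (fun t => `|t| `^ p)) normr0 powR0 ?gt_eqF // normrN subrr mul0r.
rewrite mulr0 subr0 gtr0_norm // /quad !rtraceD !rtraceZ !mul0r add0r addr0.
rewrite rtrace_sum_arrow_sqr -cN; field.
by rewrite gt_eqF.
Qed.

Lemma norm_coin (p : R) : 0 < p ->
  (((N%:R * #|V|%:R) `^ p^-1)%:E <= @norm_Lp R F p (ex_mart (@coin R N) N))%E.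
Proof.
move=> p0; rewrite /norm_Lp /ex_mart psum_stopped sum_coin.
have resP := resolution_coord_proj (@std_basisP R I).
rewrite /Lp_norm (modulus_powR_spec resP).
rewrite [trace_ext _ _ _](trace_ext_basis e resP); last first.
  by move=> k; exact: powR_ge0.
rewrite poweR_EFin lee_fin ge0_ler_powR ?nnegrE ?invr_ge0 ?(ltW p0) ?mulr_ge0 //.
  apply: sumr_ge0 => i _; rewrite (rtrace_coord_proj std_basisP) mulr1.
  exact: powR_ge0.
under [leRHS]eq_bigr do rewrite (rtrace_coord_proj std_basisP) mulr1.
apply: (sum_coin_value_ge (f := fun t => t `^ p)) => [t|]; first exact: powR_ge0.
by rewrite powR1.
Qed.

Lemma large_coin :
  ((N%:R * #|V|%:R)%:E <=
    @tr R F (spectral_projection `[1%R, +oo[ (modulus (ex_mart (@coin R N) N))))%E.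
Proof.
rewrite /tr /ex_mart psum_stopped sum_coin.
have resP := resolution_coord_proj (@std_basisP R I).
rewrite (modulus_spec resP) (spectral_projection_spec resP) //.
rewrite [trace_ext _ _ _](trace_ext_basis e resP) //.
under eq_bigr do rewrite (rtrace_coord_proj std_basisP) mulr1.
rewrite lee_fin; apply: (sum_coin_value_ge (f := \1_(`[1, +oo[))) => //.
by rewrite indicE mem_set //= in_itv /= lexx.
Qed.

End ExampleSums.

(** * Choice of the size of the example against a given constant *)

Theorem theorem5p4 (R : realType) :
  (~ exists C : R,
      forall (F : filtered_vna R) (x y : nat -> set (fvn_space F * fvn_space F)),
        self_adjoint_martingale x -> self_adjoint_martingale y ->
        tangent (mdiff x) (mdiff y) ->
        forall N : nat,
          (tr (spectral_projection `[1%R, +oo[ (modulus (y N)))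
             <= C%:E * norm_Lp 1 (x N))%E)
  /\
  (forall p : R, 1 < p < 2 ->
    ~ exists C : R,
      forall (F : filtered_vna R) (x y : nat -> set (fvn_space F * fvn_space F)),
        self_adjoint_martingale x -> self_adjoint_martingale y ->
        tangent (mdiff x) (mdiff y) ->
        forall N : nat, (norm_Lp p (y N) <= C%:E * norm_Lp p (x N))%E).
Proof.
have card_gt0 N : 0 < #|{: 'rV[bool]_N}|%:R :> R.
  by rewrite ltr0n; apply/card_gt0P; exists 0.
split.
  (* [N] is a square so that its root is the natural number [n]. The inequality becomes n^2 <= 2 C n
     after division by the number of coin patterns, against n > 2 C. *)
  move=> [C HC]; pose n := (Num.trunc (2 * C)).+1; pose N := (n * n)%N.
  have nC : 2 * C < n%:R by exact: truncnS_gt.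
  have n0 : 0 < n%:R :> R by rewrite ltr0n.
  have nN : (n%:R : R) ^+ 2 = N%:R by rewrite natrM.
  have [xm ym xy] := @ex_mart_hyps R N.
  have := le_trans (@large_coin R N) (HC (ex_vna N) _ _ xm ym xy N).
  have v0 := card_gt0 N.
  rewrite (norm_arrow n0 nN) // -EFinM lee_fin invr1 (powRr1 (ltW n0)) powRr1; last first.
    by rewrite !mulr_ge0 // ltW.
  rewrite -nN mulrA ler_pM2r //.
  by move: (n%:R : R) nC n0 => t; nra.
move=> p /andP[p1 p2] [C HC].
have p0 : 0 < p by exact: lt_trans ltr01 p1.
have q0 : 0 < 2 - p by rewrite subr_gt0.
(* The constant is enlarged to a positive [a] so that p-th powers can be taken. They give n^2 <= b
   n^p, that is n^(2-p) <= b, and [n] is chosen beyond the (2-p)-th root of [b]. *)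
pose a := `|C| + 1; have a0 : 0 < a by rewrite ltr_wpDl.
pose b := 2 * a `^ p; have b0 : 0 < b by rewrite mulr_gt0 // powR_gt0.
pose n := (Num.trunc (b `^ (2 - p)^-1)).+1; pose N := (n * n)%N.
have nb : b `^ (2 - p)^-1 < n%:R by exact: truncnS_gt.
have n0 : 0 < n%:R :> R by rewrite ltr0n.
have nN : (n%:R : R) ^+ 2 = N%:R by rewrite natrM.
have [xm ym xy] := @ex_mart_hyps R N.
have := le_trans (@norm_coin R N p p0) (HC (ex_vna N) _ _ xm ym xy N).
rewrite (norm_arrow n0 nN p0) -EFinM lee_fin.
set v : R := #|_|%:R; have v0 : 0 < v by exact: card_gt0.
move=> le_C.
have : (N%:R * v) `^ p^-1 <= a * (2 * n%:R `^ p * v) `^ p^-1.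
  apply: le_trans le_C _; rewrite ler_wpM2r ?powR_ge0 //.
  by rewrite (le_trans (ler_norm C)) // lerDl.
move=> /(ge0_ler_powR (ltW p0)).
rewrite !nnegrE mulr_ge0 ?powR_ge0 ?(ltW a0) // => /(_ isT isT).
have e1 : 0 <= N%:R * v by rewrite mulr_ge0 // ltW.
have e2 : 0 <= 2 * n%:R `^ p * v by rewrite !mulr_ge0 ?powR_ge0 // ltW.
rewrite (powRM _ (ltW a0) (powR_ge0 _ _)) -!powRrM mulVf ?gt_eqF // !powRr1 //.
rewrite mulrA ler_pM2r // -nN mulrA [a `^ p * 2]mulrC -/b.
have -> : (n%:R : R) ^+ 2 = n%:R `^ (2 - p) * n%:R `^ p.
  rewrite -powRD ?subrK; last by rewrite gt_eqF // implybT.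
  by rewrite powR_mulrn // ltW.
rewrite ler_pM2r ?powR_gt0 //.
apply/negP; rewrite -ltNge.
have := gt0_ltr_powR q0 _ _ nb.
rewrite !nnegrE powR_ge0 ltW // => /(_ isT isT).
by rewrite -powRrM mulVf ?gt_eqF // powRr1 // ltW.
Qed.
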